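(* Let $n\ge 2$ and $1\le s\le n$. If $X_1,\dots,X_s$ are (infinite-dimensional) $\mathcal{L}_\infty$-spaces then, for any choice of Banach spaces $X_{s+1},\dots,X_n$, $$\mathcal{L}(X_1,\dots,X_n)=\mathcal{L}_{as(1;q_1,\dots,q_n)}(X_1,\dots,X_n),$$ where $q_1=\cdots=q_s=2$ and $q_{s+1}=\cdots=q_n=1$.
   Context: The scalar field $\mathbb{K}$ is either $\mathbb{R}$ or $\mathbb{C}$. $\mathcal{L}_\infty$-spaces are meant in the sense of Lindenstrauss and Pełczyński, and are always assumed infinite-dimensional. $\mathcal{L}(X_1,\dots,X_n)$ is the Banach space of continuous $n$-linear mappings from $X_1\times\cdots\times X_n$ into $\mathbb{K}$. For a finite sequence $(x_j)_{j=1}^k$ in a Banach space $X$ and $q>0$, $\|(x_j)_{j=1}^k\|_{w,q}=\sup_{\varphi\in B_{X'}}\left(\sum_{j=1}^k|\varphi(x_j)|^q\right)^{1/q}$, where $B_{X'}$ is the closed unit ball of the dual $X'$. A continuous $n$-linear mapping $A:X_1\times\cdots\times X_n\to \mathbb{K}$ is absolutely $(p;q_1,\dots,q_n)$-summing if there is a constant $L\ge 0$ such that $$\left(\sum_{j=1}^k|A(x_1^{(j)},\dots,x_n^{(j)})|^p\right)^{1/p}\le L\prod_{i=1}^n\|(x_i^{(j)})_{j=1}^k\|_{w,q_i}$$ for every $k\in\mathbb{N}$ and all $x_i^{(1)},\dots,x_i^{(k)}\in X_i$, $i=1,\dots,n$. The space of all such mappings is $\mathcal{L}_{as(p;q_1,\dots,q_n)}(X_1,\dots,X_n)$.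 *)

(* Defs.v *)
From HB Require Import structures.
From mathcomp Require Import all_boot all_order all_algebra.
From mathcomp Require Import complex.
From mathcomp Require Import all_classical all_reals all_analysis.

Set Implicit Arguments.
Unset Strict Implicit.
Unset Printing Implicit Defensive.

Import Order.TTheory GRing.Theory Num.Theory.
Import numFieldNormedType.Exports.

Local Open Scope classical_set_scope.
Local Open Scope ring_scope.

Inductive scalar_kind := RealScalars | ComplexScalars.

Definition scalar_field (R : realType) (k : scalar_kind) : numFieldType :=
  match k with
  | RealScalars => R
  | ComplexScalars => R[i]
  end.

Definition scalar_re (R : realType) (k : scalar_kind) : scalar_field R k -> R :=
  match k return scalar_field R k -> R with
  | RealScalars => fun x => x
  | ComplexScalars => fun z => complex.Re z
  end.

(* The norm of a normedModType K takes its values in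
   K, hence in (the nonnegative reals of) R[i] when the scalars are complex;
   rnorm is the same norm with values in R. *)
Definition rnorm (R : realType) (k : scalar_kind)
    (V : normedModType (scalar_field R k)) (x : V) : R :=
  scalar_re `|x|.

(* The operator norm on a subspace F of V: the supremum of the norms of the
   values on the closed unit ball of F, +oo for an unbounded f. *)
Definition opnorm (R : realType) (k : scalar_kind)
    (V W : normedModType (scalar_field R k)) (F : set V) (f : V -> W) : \bar R :=
  ereal_sup [set (rnorm (f x))%:E | x in F `&` [set x | rnorm x <= 1]].

Definition dual_ball (R : realType) (k : scalar_kind)
    (V : normedModType (scalar_field R k)) : set {linear V -> (scalar_field R k)^o} :=
  [set phi : {linear V -> (scalar_field R k)^o} | continuous phi /\ (opnorm setT phi <= 1%:E)%E].

(* For q > 0 the set is nonempty and bounded by (sum_j ||x_j||^q)^(1/q), so that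
   sup is its least upper bound. *)
Definition weak_norm (R : realType) (k : scalar_kind)
    (V : normedModType (scalar_field R k)) (q : R) (m : nat) (x : 'I_m -> V) : R :=
  sup [set (\sum_(j < m) rnorm (phi (x j)) `^ q) `^ q^-1 | phi in @dual_ball R k V].

Definition finite_dim_subspace (K : fieldType) (V : lmodType K) (F : set V) :=
  exists (m : nat) (e : 'I_m -> V),
    F = range (fun a : 'I_m -> K => \sum_(i < m) a i *: e i).

(* The Banach-Mazur distance between W and the subspace F of V: T is a linear
   bijection of W onto F and S is its inverse on F (S is arbitrary off F).  It
   is +oo when there is no such T. *)
Definition banach_mazur (R : realType) (k : scalar_kind)
    (W V : normedModType (scalar_field R k)) (F : set V) : \bar R :=
  ereal_inf [set d | exists (T : {linear W -> V}) (S : V -> W),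
    [/\ range T = F, cancel T S & d = (opnorm setT T * opnorm F S)%E]].

(* The norm of 'rV_m is the maximum of the absolute values of the entries, so
   'rV[scalar_field R k]_m is the m-dimensional l_infty over the scalars. *)
Definition Linfty_lambda_space (R : realType) (k : scalar_kind)
    (V : normedModType (scalar_field R k)) (lambda : R) :=
  forall E : set V, finite_dim_subspace E ->
    exists (F : set V) (m : nat),
      [/\ finite_dim_subspace F, E `<=` F
        & (banach_mazur 'rV[scalar_field R k]_m F <= lambda%:E)%E].

Definition infinite_dim_Linfty_space (R : realType) (k : scalar_kind)
    (V : normedModType (scalar_field R k)) :=
  ~ finite_dim_subspace [set: V] /\
  exists lambda : R, 1 <= lambda /\ Linfty_lambda_space V lambda.

Definition multilinear (K : fieldType) (n : nat) (X : 'I_n -> lmodType K)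
    (A : (forall i, X i) -> K) :=
  forall (i : 'I_n) (x : forall i, X i),
    linear (fun t : X i => A (dfwith x i t) : K^o).

Definition continuous_multilinear (R : realType) (k : scalar_kind) (n : nat)
    (X : 'I_n -> normedModType (scalar_field R k)) :
    set ((forall i, X i) -> scalar_field R k) :=
  [set A | @multilinear _ n X A /\
    continuous (A : prod_topology X -> scalar_field R k)].

Definition absolutely_summing (R : realType) (k : scalar_kind) (n : nat)
    (X : 'I_n -> normedModType (scalar_field R k)) (p : R) (q : 'I_n -> R) :
    set ((forall i, X i) -> scalar_field R k) :=
  [set A | continuous_multilinear A /\
    exists L : R, 0 <= L /\
      forall (m : nat) (x : forall i, 'I_m -> X i),
        (\sum_(j < m) rnorm (A (fun i => x i j) : (scalar_field R k)^o) `^ p) `^ p^-1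
        <= L * \prod_(i < n) weak_norm (q i) (x i)].

(* Main.v *)
Require Import Defs.
From HB Require Import structures.
From mathcomp Require Import all_boot all_order all_algebra.
From mathcomp Require Import complex ring lra.
From mathcomp Require Import all_classical all_reals all_analysis.
Import Order.TTheory GRing.Theory Num.Theory.
Import numFieldNormedType.Exports.
Local Open Scope classical_set_scope.
Local Open Scope ring_scope.

(** An n-linear form on l_infty spaces satisfies a multilinear Grothendieck
    inequality: sum_t |A(u_1(t), ..., u_n(t))| <= K_n |A| as soon as the
    l_2 norms of the coordinates of the u_i are at most 1 (Blei, Tonge).  To prove it,
    replace u_i by the Rademacher sum G_i = sum_t eps_t u_i(t), whose
    Walsh-Fourier coefficients are the u_i(t), and clip G_i at height n.  The
    clipped part contributes at most n^n |A|, since sum_S A(B_1^(S), ..., B_n^(S))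
    is an average of values of A at bounded vectors.  By the fourth moment
    estimate E G^4 <= 3 (E G^2)^2 each of the n remainder terms has a coordinate
    of l_2 norm at most 1/(2n), so by Parseval it is at most K_n |A| / (2n); hence
    K_n <= 2 n^n.

    Families with weak 1-norm at most 1 in any space are images of the unit
    vectors of l_infty^m under a map of norm at most 1.  In an L_infty-space
    finite families lie in subspaces that are uniformly isomorphic to l_infty^d,
    and the coordinate functionals extend by the Hahn-Banach theorem, so that weak
    2-norms become sup over k of the l_2 norms of the k-th coordinates.  Complex
    scalars are split into real and imaginary parts. *)

Set Implicit Arguments.
Unset Strict Implicit.
Unset Printing Implicit Defensive.

(** * Walsh-Fourier analysis *)

Section Walsh.
Variables (R : realFieldType) (T : finType).
Local Notation Omega := {ffun T -> bool}.
Implicit Types (S V W : Omega) (f : Omega -> R) (u : T -> R).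

Definition walsh S W : R := \prod_t (-1) ^+ (S t && W t).

Definition expect f : R := 2 ^- #|T| * \sum_W f W.

Definition fourier f S : R := expect (fun W => walsh S W * f W).

Definition rademacher u W : R := \sum_t (-1) ^+ W t * u t.

Definition xor_ffun V W : Omega := [ffun t => V t (+) W t].

Lemma xor_ffunK V : involutive (xor_ffun V).
Proof. by move=> W; apply/ffunP => t; rewrite !ffunE addKb. Qed.

Lemma walshC S W : walsh S W = walsh W S.
Proof. by apply: eq_bigr => t _; rewrite andbC. Qed.

Lemma walshM S V W : walsh S V * walsh S W = walsh S (xor_ffun V W).
Proof.
rewrite -big_split; apply: eq_bigr => t _ /=; rewrite !ffunE -signr_addb.
by congr (_ ^+ _); case: (S t).
Qed.

(** The sum over [S] factors as the product over [t] of [1 + (-1) ^+ (V t (+) W t)], and the factor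
    at a point where [V] and [W] differ is zero. *)
Lemma walsh_orthogonal V W :
  \sum_S walsh S V * walsh S W = if V == W then 2 ^+ #|T| else 0.
Proof.
transitivity (\prod_t (1 + (-1) ^+ (V t (+) W t)) : R).
  rewrite -[RHS]/(\prod_t _).
  under [RHS]eq_bigr => t _.
    have -> : 1 + (-1) ^+ (V t (+) W t)
      = \sum_(b : bool) (-1) ^+ (b && (V t (+) W t)) :> R.
      by rewrite big_bool /= addrC expr0.
    over.
  rewrite bigA_distr_bigA; apply: eq_bigr => S _; rewrite walshM.
  by apply: eq_bigr => t _; rewrite ffunE.
case: eqP => [->|/eqP neVW].
  under eq_bigr do rewrite addbb expr0.
  by rewrite prodr_const.
have /existsP[t neVWt] : [exists t, V t != W t].
  apply: contraR neVW; rewrite negb_exists => /forallP eqVW.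
  by apply/eqP/ffunP => t; apply/eqP; have := eqVW t; rewrite negbK.
rewrite (bigD1 t) //=; suff -> : V t (+) W t by rewrite expr1 subrr mul0r.
by case: (V t) (W t) neVWt => [] [].
Qed.

Lemma expectD f g : expect (fun W => f W + g W) = expect f + expect g.
Proof. by rewrite /expect big_split mulrDr. Qed.

Lemma expectZ a f : expect (fun W => a * f W) = a * expect f.
Proof. by rewrite /expect -mulr_sumr mulrCA. Qed.

Lemma expect_cst a : expect (fun=> a) = a.
Proof.
rewrite /expect sumr_const card_ffun card_bool -[in X in _ * X]mulr_natl natrX.
by rewrite mulKf // expf_neq0 // pnatr_eq0.
Qed.

Lemma le_expect f g : (forall W, f W <= g W) -> expect f <= expect g.
Proof.
move=> le_fg; rewrite ler_wpM2l ?ler_sum// invr_ge0 exprn_ge0 //.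
Qed.

Lemma expect_xor V f : expect (fun W => f (xor_ffun V W)) = expect f.
Proof.
rewrite /expect [in RHS](reindex_inj (inv_inj (xor_ffunK V))) //.
Qed.

Lemma parseval f : \sum_S fourier f S ^+ 2 = expect (fun W => f W ^+ 2).
Proof.
have N0 : 2 ^+ #|T| != 0 :> R by rewrite expf_neq0 // pnatr_eq0.
transitivity (2 ^- #|T| * (2 ^- #|T| *
  \sum_V \sum_W (\sum_S walsh S V * walsh S W) * (f V * f W))).
  rewrite mulrA mulr_sumr.
  under eq_bigr => S _.
    rewrite /fourier /expect exprMn (expr2 (\sum__ _)) mulr_suml.
    under eq_bigr do rewrite mulr_sumr.
    over.
  rewrite -mulr_sumr -expr2 -mulr_sumr; congr (_ * _).
  rewrite exchange_big; apply: eq_bigr => V _ /=.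
  rewrite exchange_big; apply: eq_bigr => W _ /=.
  rewrite mulr_suml; apply: eq_bigr => S _; ring.
rewrite /expect; congr (_ * _); rewrite mulr_sumr; apply: eq_bigr => V _.
under eq_bigr do rewrite walsh_orthogonal.
rewrite (bigD1 V) //= eqxx big1 ?addr0 ?mulKf ?expr2 // => W neWV.
by rewrite eq_sym (negbTE neWV) mul0r.
Qed.

(** Fourier inversion at the zero of the group, where every character equals 1. *)
Lemma sum_fourier f : \sum_S fourier f S = f [ffun=> false].
Proof.
have N0 : 2 ^+ #|T| != 0 :> R by rewrite expf_neq0 // pnatr_eq0.
rewrite /fourier /expect -mulr_sumr exchange_big /=.
under eq_bigr => W _.
  rewrite -mulr_suml.
  have -> : \sum_S walsh S W = \sum_S walsh S W * walsh S [ffun=> false].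
    apply: eq_bigr => S _; rewrite [X in _ * X]/walsh big1 ?mulr1 // => t _.
    by rewrite ffunE andbF.
  rewrite walsh_orthogonal; over.
rewrite (bigD1 [ffun=> false]) //= eqxx big1 ?addr0 ?mulKf // => W /negbTE ->.
by rewrite mul0r.
Qed.

Lemma fourier_xor V f S :
  fourier (fun W => f (xor_ffun V W)) S = walsh S V * fourier f S.
Proof.
rewrite -[RHS]expectZ -[RHS](expect_xor V); congr expect; apply/funext => W.
by rewrite mulrA walshM xor_ffunK.
Qed.

(** These index the characters that are single signs; the Fourier transform of a Rademacher sum
    lives on them. *)
Definition dirac_ffun t : Omega := [ffun t' => t' == t].

Lemma dirac_ffun_inj : injective dirac_ffun.
Proof.
by move=> s t /ffunP/(_ s); rewrite !ffunE eqxx => /esym/eqP.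
Qed.

Lemma walsh_dirac t W : walsh (dirac_ffun t) W = (-1) ^+ W t.
Proof.
rewrite /walsh (bigD1 t) //= ffunE eqxx big1 ?mulr1 // => t' /negbTE.
by rewrite ffunE => ->.
Qed.

Lemma fourier_rademacher u S :
  fourier (rademacher u) S = \sum_t (S == dirac_ffun t)%:R * u t.
Proof.
have N0 : 2 ^+ #|T| != 0 :> R by rewrite expf_neq0 // pnatr_eq0.
rewrite /fourier /expect.
under eq_bigr do rewrite mulr_sumr.
rewrite exchange_big mulr_sumr; apply: eq_bigr => t _ /=.
under eq_bigr do rewrite -walsh_dirac mulrA walshC (walshC (dirac_ffun t)).
rewrite -mulr_suml walsh_orthogonal mulrA; congr (_ * _).
by case: eqP => _; rewrite ?mulr0 ?mulVf.
Qed.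

(** Induction on the list of signs, with both moments together because the fourth uses the second.
    If [Q] is the sum of squares so far, a new term with square [a] leads to
    [a^2 + 6 a Q + 3 Q^2 <= 3 (a + Q)^2]. *)
Lemma fourth_moment u :
  expect (fun W => rademacher u W ^+ 2) = \sum_t u t ^+ 2 /\
  expect (fun W => rademacher u W ^+ 4) <= 3 * (\sum_t u t ^+ 2) ^+ 2.
Proof.
rewrite /rademacher; elim: (index_enum T) (index_enum_uniq T) => [|t r IH] /=.
  move=> _; under eq_fun do rewrite big_nil expr0n.
  under [in X in _ /\ X]eq_fun do rewrite big_nil expr0n.
  by rewrite !expect_cst !big_nil expr0n mulr0.
case/andP => tr /IH [IH2 IH4]; rewrite big_cons.
set Q := \sum_(t <- r) u t ^+ 2 in IH2 IH4 *.
set F := fun W : Omega => \sum_(t <- r) (-1) ^+ W t * u t in IH2 IH4 *.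
(* Flipping the sign at [t] preserves the average, negates the first factor and leaves [F] alone
   because [t] is not in [r]. *)
have odd_moment m : expect (fun W => (-1) ^+ W t * F W ^+ m) = 0.
  set e := expect _; suff : e = - e.
    by move/eqP; rewrite -subr_eq0 opprK -mulr2n mulrn_eq0 => /eqP.
  rewrite -[LHS](expect_xor (dirac_ffun t)) -[RHS]mulN1r -[RHS]expectZ.
  congr expect; apply/funext => W; rewrite !ffunE eqxx signr_addb -!mulrA.
  congr (_ * (_ * _ ^+ _)); rewrite /F [LHS]big_seq [RHS]big_seq.
  apply: eq_bigr => t' rt'; rewrite !ffunE.
  by case: eqP rt' tr => [->->|].
have sq W : ((-1) ^+ W t) ^+ 2 = 1 :> R by rewrite sqrr_sign.
split.
  have -> : (fun W : Omega => (\sum_(j <- t :: r) (-1) ^+ W j * u j) ^+ 2)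
     = (fun W => (u t ^+ 2 + 2 * u t * ((-1) ^+ W t * F W ^+ 1)) + F W ^+ 2).
    apply/funext => W; rewrite big_cons -/(F W).
    have := sq W; set e := (-1) ^+ W t; move: (F W) => z e2.
    transitivity (e ^+ 2 * u t ^+ 2 + 2 * u t * (e * z) + z ^+ 2); first ring.
    by rewrite e2 mul1r.
  by rewrite !expectD expectZ odd_moment expect_cst IH2 mulr0 addr0.
have -> : (fun W : Omega => (\sum_(j <- t :: r) (-1) ^+ W j * u j) ^+ 4)
  = (fun W => ((u t ^+ 4 + 4 * u t ^+ 3 * ((-1) ^+ W t * F W ^+ 1))
     + (6 * u t ^+ 2 * F W ^+ 2 + 4 * u t * ((-1) ^+ W t * F W ^+ 3)))
     + F W ^+ 4).
  apply/funext => W; rewrite big_cons -/(F W).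
  have := sq W; set e := (-1) ^+ W t; move: (F W) => z e2.
  have e4 : e ^+ 4 = 1 by rewrite (exprM e 2 2) e2 expr1n.
  have e3 : e ^+ 3 = e by rewrite exprS e2 mulr1.
  transitivity (e ^+ 4 * u t ^+ 4 + 4 * e ^+ 3 * u t ^+ 3 * z
    + 6 * e ^+ 2 * u t ^+ 2 * z ^+ 2 + 4 * e * u t * z ^+ 3 + z ^+ 4); first ring.
  rewrite e4 e3 e2; ring.
rewrite !expectD (expectZ (4 * u t ^+ 3)) (expectZ (6 * u t ^+ 2)).
rewrite (expectZ (4 * u t)) !odd_moment expect_cst IH2 !mulr0 !addr0.
have := sqr_ge0 (u t ^+ 2); move: IH4; move: (expect _) => E4.
have -> : u t ^+ 4 = (u t ^+ 2) ^+ 2 by rewrite -exprM.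
move: (u t ^+ 2) => a IH4 a2; nra.
Qed.

End Walsh.

(** * Real multilinear forms *)

Section RealMultilinear.
Variables (R : realType) (I : finType).

Definition real_multilinear (J : eqType) (A : (J -> I -> R) -> R) :=
  forall (x : J -> I -> R) i a v w,
    A (dfwith x i (fun k => a * v k + w k))
    = a * A (dfwith x i v) + A (dfwith x i w).

Section Basics.
Variables (J : finType) (A : (J -> I -> R) -> R).
Hypothesis linA : real_multilinear A.
Implicit Types (x : J -> I -> R) (i : J) (v w : I -> R).

Lemma dfwith_id x i : dfwith x i (x i) = x.
Proof.
by apply/funext => j; case: dfwithP.
Qed.

Lemma multilinear0 x i : A (dfwith x i (fun=> 0)) = 0.
Proof.
have := linA x i 1 (fun=> 0) (fun=> 0).
have -> : (fun=> 1 * 0 + 0) = (fun=> 0) :> (I -> R).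
  by apply/funext => k; rewrite mulr0 addr0.
by rewrite mul1r => /eqP; rewrite -subr_eq0 opprD addNKr oppr_eq0 => /eqP.
Qed.

Lemma multilinearZ x i a v :
  A (dfwith x i (fun k => a * v k)) = a * A (dfwith x i v).
Proof.
rewrite -[RHS]addr0 -(multilinear0 x i) -linA; congr (A (dfwith x i _)).
by apply/funext => k; rewrite addr0.
Qed.

Lemma multilinear_sum (S : Type) (r : seq S) x i (c : S -> R) (v : S -> I -> R) :
  A (dfwith x i (fun k => \sum_(s <- r) c s * v s k))
  = \sum_(s <- r) c s * A (dfwith x i (v s)).
Proof.
elim: r => [|s r IH].
  rewrite big_nil -[RHS](multilinear0 x i); congr (A (dfwith x i _)).
  by apply/funext => k; rewrite big_nil.
rewrite big_cons -IH -linA; congr (A (dfwith x i _)).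
by apply/funext => k; rewrite big_cons.
Qed.

Lemma multilinearB x i v :
  A x - A (dfwith x i v) = A (dfwith x i (fun k => x i k - v k)).
Proof.
have -> : (fun k => x i k - v k) = (fun k => -1 * v k + x i k).
  by apply/funext => k; rewrite mulN1r addrC.
by rewrite linA mulN1r dfwith_id addrC.
Qed.

(** Scalars are pulled out one coordinate at a time along a duplicate-free list, so that each occurs
    exactly once. *)
Lemma multilinear_scale (c : J -> R) x :
  A (fun i k => c i * x i k) = (\prod_i c i) * A x.
Proof.
suff scale_seq (r : seq J) : uniq r ->
    A (fun i k => (if i \in r then c i else 1) * x i k)
    = (\prod_(i <- r) c i) * A x.
  rewrite -(scale_seq _ (index_enum_uniq J)); congr A.
  by apply/funext => i; rewrite mem_index_enum.
elim: r => [_|i r IH /= /andP[ir /IH {}IH]].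
  rewrite big_nil mul1r; congr A; apply/funext => i; apply/funext => k.
  by rewrite mul1r.
rewrite big_cons -mulrA -IH -[X in c i * A X](dfwith_id _ i) -multilinearZ.
congr A; apply/funext => j; case: dfwithP => [|j' ne]; rewrite inE.
  by rewrite eqxx (negbTE ir); apply/funext => k; rewrite mul1r.
by rewrite eq_sym (negbTE ne).
Qed.

Variable C : R.
Hypothesis A_le : forall x, (forall i k, `|x i k| <= 1) -> `|A x| <= C.

Lemma multilinear_bound (c : J -> R) x :
  (forall i, 0 <= c i) -> (forall i k, `|x i k| <= c i) ->
  `|A x| <= C * \prod_i c i.
Proof.
move=> c0 xc.
(* Where [c i] is 0 so is [x i], in agreement with division by zero giving 0. *)
have -> : x = fun i k => c i * (x i k / c i).
  apply/funext => i; apply/funext => k; have [ci0|ci0] := eqVneq (c i) 0.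
    by have := xc i k; rewrite ci0 normr_le0 mul0r => /eqP.
  by rewrite mulrC divfK.
have prod_ge0 : 0 <= \prod_i c i by apply: prodr_ge0.
rewrite (multilinear_scale c (fun i k => x i k / c i)) normrM mulrC.
rewrite (ger0_norm prod_ge0) ler_wpM2r //; apply: A_le => i k.
rewrite normrM normfV (ger0_norm (c0 i)).
have [->|ci0] := eqVneq (c i) 0; first by rewrite invr0 mulr0.
by rewrite ler_pdivrMr ?mul1r // lt_neqAle eq_sym ci0 c0.
Qed.

Lemma bound_ge0 : 0 <= C.
Proof.
apply: le_trans (normr_ge0 _) (A_le (x := fun _ _ => 0) _) => i k.
by rewrite normr0.
Qed.

End Basics.
End RealMultilinear.

(** * Fourier coefficients of bounded functions: the main term *)

Section MainTerm.
Variables (R : realType) (I T : finType) (n : nat).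
Variables (A : ('I_n.+1 -> I -> R) -> R) (C M : R).
Hypothesis linA : real_multilinear A.
Hypothesis A_le : forall x, (forall i k, `|x i k| <= 1) -> `|A x| <= C.
Hypothesis M0 : 0 <= M.
Local Notation Omega := {ffun T -> bool}.

(** The coordinates below [j] are those already made constant in the induction; evaluating them at
    zero reads off the constant. *)
Let partial_fourier (f : 'I_n.+1 -> I -> Omega -> R) (j : nat) (S : Omega) :
    'I_n.+1 -> I -> R :=
  fun i k => if (i < j)%N then f i k [ffun=> false] else fourier (f i k) S.

(* Once all coordinates but the last one are constant, summing over S evaluates
   the last function at 0.  A coordinate is made constant by expanding its
   Fourier coefficients: the factor walsh S W is moved to the last coordinate,
   where it becomes a translation. *)
Let partial_fourier_bound f j : (j <= n)%N -> (forall i k W, `|f i k W| <= M) ->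
  `|\sum_S A (partial_fourier f (n - j) S)| <= C * M ^+ n.+1.
Proof.
have all_M x : (forall i k, `|x i k| <= M) -> `|A x| <= C * M ^+ n.+1.
  move=> xM; apply: le_trans (multilinear_bound linA A_le (c := fun=> M) _ xM) _ => //.
  by rewrite prodr_const card_ord.
elim: j f => [|j IH] f.
  rewrite subn0 => _ fM.
  set z : 'I_n.+1 -> I -> R := fun i k => f i k [ffun=> false].
  suff -> : \sum_S A (partial_fourier f n S) = A z.
    by apply: all_M => i k; exact: fM.
  transitivity (\sum_S 1 * A (dfwith z ord_max (fun k => fourier (f ord_max k) S))).
    apply: eq_bigr => S _; rewrite mul1r; congr A.
    apply/funext => i; rewrite /partial_fourier.
    case: dfwithP => [|{}i ne]; first by rewrite ltnn.
    suff -> : (i < n)%N by [].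
    by rewrite ltn_neqAle -ltnS ltn_ord andbT eq_sym; exact: ne.
  rewrite -multilinear_sum // -[in RHS](dfwith_id z ord_max).
  congr (A (dfwith z ord_max _)); apply/funext => k.
  by under eq_bigr do rewrite mul1r; rewrite sum_fourier.
(* The coordinate expanded now is the first one not yet constant; it differs from the last one
   because [j < n]. *)
move=> jn fM; have lt_n : (n - j.+1 < n.+1)%N by rewrite ltnS leq_subr.
pose i0 := Ordinal lt_n.
have ne_i0 : i0 != ord_max by rewrite -val_eqE /= neq_ltn ltn_subrL (leq_trans _ jn).
pose g W : 'I_n.+1 -> I -> Omega -> R := fun i k V =>
  if i == i0 then f i k W else
  if i == ord_max then f i k (xor_ffun W V) else f i k V.
have g_le W : `|\sum_S A (partial_fourier (g W) (n - j) S)| <= C * M ^+ n.+1.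
  apply: IH => [|i k V]; first exact: ltnW.
  by rewrite /g; case: ifP => // _; case: ifP.
suff -> : \sum_S A (partial_fourier f (n - j.+1) S)
    = expect (fun W => \sum_S A (partial_fourier (g W) (n - j) S)).
  rewrite ler_norml -{1}(expect_cst T (- _)) -{2}(expect_cst T (C * _)).
  by apply/andP; split; apply: le_expect => W; have := g_le W;
    rewrite ler_norml => /andP[].
rewrite /expect exchange_big mulr_sumr; apply: eq_bigr => S _ /=.
set x := partial_fourier f _ S.
rewrite -(dfwith_id x i0).
have -> : x i0 = (fun k => \sum_W (2 ^- #|T| * walsh R S W) * f i0 k W).
  apply/funext => k; rewrite /x /partial_fourier ltnn /fourier /expect mulr_sumr.
  by apply: eq_bigr => W _; rewrite mulrA.
rewrite multilinear_sum // mulr_sumr; apply: eq_bigr => W _.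
rewrite -mulrA; congr (_ * _); set y := dfwith x i0 _.
rewrite -(dfwith_id y ord_max) -multilinearZ //; congr A.
apply/funext => i; apply/funext => k; rewrite /partial_fourier /g.
have [ei|nei] := eqVneq ord_max i.
  rewrite -ei dfwithin /y dfwithout // /x /partial_fourier ltnNge leq_subr /=.
  rewrite ltnNge leq_subr /= eq_sym (negbTE ne_i0) ?eqxx.
  by rewrite fourier_xor.
rewrite dfwithout // /y.
have [ei|nei0] := eqVneq i0 i.
  by rewrite -ei dfwithin ?eqxx /= subnSK ?leqnn // ltn_subrL.
rewrite dfwithout // /x /partial_fourier.
have -> // : (i < n - j)%N = (i < n - j.+1)%N.
have -> : (n - j)%N = (n - j.+1).+1 by rewrite subnSK.
rewrite ltnS leq_eqVlt; suff -> : (val i == n - j.+1)%N = false by [].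
by apply: negbTE; rewrite eq_sym; exact: nei0.
Qed.

Lemma fourier_main_term (f : 'I_n.+1 -> I -> Omega -> R) :
  (forall i k W, `|f i k W| <= M) ->
  `|\sum_S A (fun i k => fourier (f i k) S)| <= C * M ^+ n.+1.
Proof.
move=> fM; have := partial_fourier_bound (leqnn n) fM; rewrite subnn.
by under eq_bigr do rewrite /partial_fourier.
Qed.

End MainTerm.

(** * The multilinear Grothendieck inequality *)

Section Clip.
Variables (R : realFieldType) (M : R).
Hypothesis M0 : 0 < M.

Definition clip (x : R) : R := if `|x| <= M then x else Num.sg x * M.

Lemma clip_le x : `|clip x| <= M.
Proof.
rewrite /clip; case: ifP => // _; rewrite normrM (gtr0_norm M0) ler_piMl ?(ltW M0) //.
by rewrite normr_sg lern1 leq_b1.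
Qed.

Lemma clip_sqr x : clip x ^+ 2 <= x ^+ 2.
Proof.
rewrite /clip; case: ifPn => //; rewrite -ltNge => lt_x.
rewrite -[_ ^+ 2]real_normK ?num_real // -[x ^+ 2]real_normK ?num_real //.
rewrite normrM (gtr0_norm M0) lerXn2r ?nnegrE ?mulr_ge0 //; first exact: ltW.
by apply: le_trans (ltW lt_x); rewrite ler_piMl ?(ltW M0) // normr_sg lern1 leq_b1.
Qed.

(* By AM-GM, |x| - M <= x^2 / (4 M). *)
Lemma clip_remainder x : (x - clip x) ^+ 2 <= x ^+ 4 / (16 * M ^+ 2).
Proof.
rewrite ler_pdivlMr ?mulr_gt0 ?exprn_gt0 //.
rewrite /clip; case: ifPn => [_|].
  by rewrite subrr expr0n mul0r -[4%N]/(2 * 2)%N exprM sqr_ge0.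
rewrite -ltNge => lt_x.
have -> : (x - Num.sg x * M) ^+ 2 = (`|x| - M) ^+ 2.
  rewrite {1}[x]numEsg -mulrBr exprMn sqr_sg.
  suff -> : x != 0 by rewrite mul1r.
  by rewrite -normr_gt0 (lt_trans M0).
have -> : x ^+ 4 = (`|x| ^+ 2) ^+ 2 by rewrite real_normK ?num_real // -exprM.
have -> : (`|x| - M) ^+ 2 * (16 * M ^+ 2) = (4 * M * (`|x| - M)) ^+ 2 by ring.
rewrite lerXn2r ?nnegrE ?sqr_ge0 // ?mulr_ge0 ?subr_ge0 ?(ltW M0) ?(ltW lt_x) //.
have := sqr_ge0 (`|x| - 2 * M); nra.
Qed.

End Clip.

(** * The self-improving estimate for the best constant *)

Section Grothendieck.
Variables (R : realType) (I : finType) (n : nat).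
Variables (A : ('I_n.+2 -> I -> R) -> R) (C : R).
Hypothesis linA : real_multilinear A.
Hypothesis A_le : forall x, (forall i k, `|x i k| <= 1) -> `|A x| <= C.

(** In l_infty over [I] the weak 2-norm is attained on coordinate functionals, hence one sum of
    squares for each [k]. *)
Definition weakly_bounded (T : finType) (u : T -> 'I_n.+2 -> I -> R)
    (c : 'I_n.+2 -> R) :=
  forall i k, \sum_t u t i k ^+ 2 <= c i ^+ 2.

(** The bound depends on [I] and serves only to make the supremum [K] finite, so that [K / 2] can be
    absorbed. Two coordinates are measured by their l_2 norms over [I], the others by 1; then
    [a b <= (a^2 + b^2) / 2] is summed over [t]. *)
Lemma crude_bound (T : finType) (u : T -> 'I_n.+2 -> I -> R) :
  weakly_bounded u (fun=> 1) -> \sum_t `|A (u t)| <= C * #|I|%:R.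
Proof.
move=> u1; pose i1 : 'I_n.+2 := lift ord0 ord0.
pose a i t := Num.sqrt (\sum_k u t i k ^+ 2).
have a2 i t : a i t ^+ 2 = \sum_k u t i k ^+ 2.
  by rewrite sqr_sqrtr // sumr_ge0 // => k _; exact: sqr_ge0.
have le_a i k t : `|u t i k| <= a i t.
  rewrite -(@ler_pXn2r _ 2) ?nnegrE ?sqrtr_ge0 // a2 real_normK ?num_real //.
  by rewrite (bigD1 k) //= lerDl sumr_ge0 // => j _; exact: sqr_ge0.
have C0 := bound_ge0 A_le.
have A_ut t : `|A (u t)| <= C * ((a ord0 t ^+ 2 + a i1 t ^+ 2) / 2).
  pose c i := if i == ord0 then a ord0 t else if i == i1 then a i1 t else 1.
  have c0 i : 0 <= c i by rewrite /c; repeat case: ifP => _ //; exact: sqrtr_ge0.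
  have uc i k : `|u t i k| <= c i.
    rewrite /c; case: eqP => [->//|_]; case: eqP => [->//|_].
    rewrite -(@ler_pXn2r _ 2) ?nnegrE // expr1n real_normK ?num_real //.
    have := u1 i k; rewrite expr1n; apply: le_trans.
    by rewrite (bigD1 t) //= lerDl sumr_ge0 // => j _; exact: sqr_ge0.
  apply: le_trans (multilinear_bound linA A_le c0 uc) _.
  apply: ler_wpM2l => //; rewrite (bigD1 ord0) // (bigD1 i1) //= big1 => [|i].
    rewrite /c eqxx mulr1 ler_pdivlMr //.
    have := sqr_ge0 (a ord0 t - a i1 t); nra.
  by rewrite /c => /andP[/negbTE -> /negbTE ->].
apply: le_trans (ler_sum _ (fun t _ => A_ut t)) _.
rewrite -mulr_sumr ler_wpM2l // -mulr_suml ler_pdivrMr // big_split /=.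
rewrite mulr_natr mulr2n; apply: lerD.
all: under eq_bigr do rewrite a2.
all: rewrite exchange_big /= -sum1_card natr_sum ler_sum // => k _.
all: by have := u1 _ k; rewrite expr1n; apply.
Qed.

(** The absolute value stands outside the sum because Fourier expansion acts on the sum itself;
    signs are restored in [multilinear_grothendieck]. Ordinals represent all finite index sets. *)
Let sums : set R := [set r | exists (m : nat) (u : 'I_m -> 'I_n.+2 -> I -> R),
  weakly_bounded u (fun=> 1) /\ r = `|\sum_t A (u t)|].

Let K := sup sums.

Let sums_has_sup : has_sup sums.
Proof.
split.
  exists `|\sum_(t < 0) A (fun _ _ => 0)|, 0%N, (fun _ _ _ => 0); split => // i k.
  by rewrite big_ord0 expr1n.
exists (C * #|I|%:R) => _ [m [u [u1 ->]]].
exact: le_trans (ler_norm_sum _ _ _) (crude_bound u1).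
Qed.

(** Rescaling reduces this to the definition of [K]. Unequal [c i] serve the remainder terms, in
    which a single coordinate is small. *)
Let sum_le_K (T : finType) (u : T -> 'I_n.+2 -> I -> R) c :
  (forall i, 0 <= c i) -> weakly_bounded u c -> `|\sum_t A (u t)| <= K * \prod_i c i.
Proof.
move=> c0 uc.
have sum0 i k t : c i = 0 -> u t i k = 0.
  move=> ci0; have := uc i k; rewrite ci0 expr0n /= => le0.
  apply/eqP; rewrite -sqrf_eq0; apply/eqP/le_anti; rewrite sqr_ge0 andbT.
  apply: le_trans le0; rewrite (bigD1 t) //= lerDl sumr_ge0 // => j _.
  exact: sqr_ge0.
have -> : \sum_t A (u t) = (\prod_i c i) * \sum_t A (fun i k => u t i k / c i).
  rewrite mulr_sumr; apply: eq_bigr => t _; rewrite -multilinear_scale //.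
  congr A; apply/funext => i; apply/funext => k.
  have [ci0|ci0] := eqVneq (c i) 0; first by rewrite ci0 mul0r sum0.
  by rewrite mulrC divfK.
have prod_ge0 : 0 <= \prod_i c i by apply: prodr_ge0.
rewrite normrM (ger0_norm prod_ge0) mulrC ler_wpM2r //.
apply: sup_upper_bound sums_has_sup _ _.
exists #|T|, (fun j i k => u (enum_val j) i k / c i); split; last first.
  by rewrite -(big_enum_val (fun t => A (fun i k => u t i k / c i))).
move=> i k; rewrite expr1n.
rewrite -(big_enum_val (fun t => (u t i k / c i) ^+ 2)) /=.
have [ci0|ci0] := eqVneq (c i) 0.
  by rewrite big1 // => t _; rewrite sum0 // mul0r expr0n.
under eq_bigr do rewrite exprMn.
by rewrite -mulr_suml exprVn ler_pdivrMr ?mul1r ?uc // exprn_even_gt0.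
Qed.

Let N : R := n.+2%:R.

Let N0 : 0 < N. Proof. by rewrite ltr0n. Qed.

Let bootstrap (T : finType) (u : T -> 'I_n.+2 -> I -> R) :
  weakly_bounded u (fun=> 1) -> `|\sum_t A (u t)| <= C * N ^+ n.+2 + K / 2.
Proof.
move=> u1.
pose G i k := rademacher (fun t => u t i k).
pose B i k W := clip N (G i k W).
pose g S i k := fourier (G i k) S; pose b S i k := fourier (B i k) S.
(* At a Dirac [S] the coefficient vectors are those of [u t]; at any other [S] they are all zero and
   [A] vanishes. *)
have gE S : A (g S) = \sum_t (S == dirac_ffun t)%:R * A (u t).
  have [/existsP[t /eqP St]|] := boolP [exists t, S == dirac_ffun t].
    have pick_t (w : T -> R) : \sum_t' (S == dirac_ffun t')%:R * w t' = w t.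
      rewrite (bigD1 t) //= St eqxx mul1r big1 ?addr0 // => t' nt.
      by rewrite (inj_eq (@dirac_ffun_inj T)) eq_sym (negbTE nt) mul0r.
    rewrite pick_t; congr A; apply/funext => i; apply/funext => k.
    by rewrite /g /G fourier_rademacher pick_t.
  rewrite negb_exists => /forallP neS.
  rewrite big1 => [|t _]; last by rewrite (negbTE (neS t)) mul0r.
  rewrite -[RHS](multilinear0 linA (g S) ord0) -[LHS](congr1 A (dfwith_id _ ord0)).
  congr (A (dfwith _ _ _)); apply/funext => k.
  by rewrite /g fourier_rademacher big1 // => t _; rewrite (negbTE (neS t)) mul0r.
have -> : \sum_t A (u t) = \sum_S A (g S).
  under [RHS]eq_bigr do rewrite gE.
  rewrite exchange_big; apply: eq_bigr => t _ /=.
  by rewrite (bigD1 (dirac_ffun t)) //= eqxx mul1r big1 ?addr0 // => S /negbTE ->;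
    rewrite mul0r.
(* Hybrids with the coordinates below [j] clipped. Consecutive ones differ in coordinate [j] only,
   so their difference is one value of [A] with the clipping remainder in that place. *)
pose h j S : 'I_n.+2 -> I -> R := fun i => if (i < j)%N then b S i else g S i.
have gh S : g S = h 0%N S by [].
have bh S : h n.+2 S = b S by apply/funext => i; rewrite /h ltn_ord.
have -> : \sum_S A (g S)
    = \sum_S A (b S) + \sum_(j < n.+2) \sum_S (A (h j S) - A (h j.+1 S)).
  rewrite exchange_big -big_split; apply: eq_bigr => S _ /=.
  rewrite (eq_bigr (fun j : 'I__ => - (A (h j.+1 S) - A (h j S)))); last first.
    by move=> j _; rewrite opprB.
  rewrite sumrN -(big_mkord xpredT (fun j => A (h j.+1 S) - A (h j S))).
  by rewrite telescope_sumr // -gh bh opprB addrC subrK.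
apply: le_trans (ler_normD _ _) (lerD _ _).
  by apply: (fourier_main_term linA A_le (ltW N0)) => i k W; exact: clip_le.
have Eu i k : expect (fun W => G i k W ^+ 2) <= 1.
  rewrite /G (fourth_moment (fun t => u t i k)).1.
  by have := u1 i k; rewrite expr1n.
have le_g i k : \sum_S g S i k ^+ 2 <= 1 by rewrite parseval.
have le_b i k : \sum_S b S i k ^+ 2 <= 1.
  by rewrite parseval; apply: le_trans (Eu i k); apply: le_expect => W; exact: clip_sqr.
have le_d i k : \sum_S (g S i k - b S i k) ^+ 2 <= (2 * N)^-1 ^+ 2.
  under eq_bigr => S _.
    have -> : g S i k - b S i k = fourier (fun W => G i k W - B i k W) S.
      rewrite /g /b /fourier -mulN1r -expectZ -expectD; congr expect.
      by apply/funext => W; ring.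
    over.
  rewrite parseval.
  have le4 W : (G i k W - B i k W) ^+ 2 <= (16 * N ^+ 2)^-1 * G i k W ^+ 4.
    by rewrite mulrC; exact: clip_remainder.
  apply: le_trans (le_expect le4) _; rewrite expectZ.
  (* The constant 3 of the fourth moment is rounded up to 4, which makes the bound a perfect
     square. *)
  have -> : (2 * N)^-1 ^+ 2 = (16 * N ^+ 2)^-1 * 4.
    by field; rewrite gt_eqF.
  rewrite ler_wpM2l ?invr_ge0 ?mulr_ge0 ?exprn_ge0 ?(ltW N0) //.
  apply: le_trans (fourth_moment (fun t => u t i k)).2 _.
  have := u1 i k; rewrite expr1n.
  have : 0 <= \sum_t u t i k ^+ 2 by apply: sumr_ge0 => t _; exact: sqr_ge0.
  move: (\sum_t _) => q; nra.
have -> : K / 2 = \sum_(j < n.+2) K * (2 * N)^-1.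
  rewrite sumr_const card_ord -mulr_natr -/N; field; exact: lt0r_neq0.
apply: le_trans (ler_norm_sum _ _ _) (ler_sum _ _) => j _.
pose c i : R := if i == j then (2 * N)^-1 else 1.
have c0 i : 0 <= c i.
  by rewrite /c; case: ifP => // _; rewrite invr_ge0 mulr_ge0 ?(ltW N0).
have -> : (2 * N)^-1 = \prod_i c i.
  rewrite (bigD1 j) //= big1 /c ?eqxx ?mulr1 // => i /negbTE ->; by [].
have -> : \sum_S (A (h j S) - A (h j.+1 S))
    = \sum_S A (dfwith (h j S) j (fun k => g S j k - b S j k)).
  apply: eq_bigr => S _.
  have -> : h j.+1 S = dfwith (h j S) j (b S j).
    apply/funext => i; case: dfwithP => [|{}i ne]; rewrite /h ?ltnSn // ltnS.
    rewrite leq_eqVlt; suff -> : (val i == val j) = false by [].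
    by apply: negbTE; rewrite eq_sym.
  by rewrite multilinearB // /h ltnn.
apply: sum_le_K => // i k; rewrite /c; case: eqP => [->|/eqP nij].
  by under eq_bigr do rewrite dfwithin.
under eq_bigr do rewrite dfwithout 1?eq_sym //.
by rewrite expr1n /h; case: (i < j)%N.
Qed.

Lemma multilinear_grothendieck (T : finType) (u : T -> 'I_n.+2 -> I -> R) :
  weakly_bounded u (fun=> 1) ->
  \sum_t `|A (u t)| <= 2 * n.+2%:R ^+ n.+2 * C.
Proof.
move=> u1.
have K_le : K <= 2 * N ^+ n.+2 * C.
  suff : K <= C * N ^+ n.+2 + K / 2 by lra.
  apply: ge_sup => [|_ [m [v [v1 ->]]]]; first exact: sums_has_sup.1.
  exact: bootstrap.
(* The sign of [A (u t)] is absorbed into coordinate 0, which does not increase the sums of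
   squares. *)
pose v t : 'I_n.+2 -> I -> R :=
  dfwith (u t) ord0 (fun k => Num.sg (A (u t)) * u t ord0 k).
have -> : \sum_t `|A (u t)| = \sum_t A (v t).
  by apply: eq_bigr => t _; rewrite multilinearZ // dfwith_id normrEsg.
apply: le_trans (ler_norm _) _.
apply: le_trans (sum_le_K (c := fun=> 1) _ _) _ => // [i k|]; last first.
  by rewrite big1 // mulr1.
rewrite /v; case: (eqVneq ord0 i) => [<-|ne]; last first.
  by under eq_bigr do rewrite dfwithout //.
under eq_bigr do rewrite dfwithin exprMn.
apply: le_trans (u1 ord0 k); apply: ler_sum => t _.
by rewrite sqr_sg ler_piMl ?sqr_ge0 // lern1 leq_b1.
Qed.

End Grothendieck.

(** * The Hahn-Banach theorem *)

Section HahnBanach.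
Variables (R : realType) (V : lmodType R) (p : V -> R).
Hypothesis pD : forall x y, p (x + y) <= p x + p y.
Hypothesis pZ : forall a x, 0 <= a -> p (a *: x) = a * p x.
Local Notation W := (V * R^o)%type.

(* Linear functionals on subspaces are represented by their graphs; domination
   by p makes such a subspace single-valued. *)
Definition dominated_graph (G : set W) :=
  [/\ G 0, forall a u v, G u -> G v -> G (a *: u + v)
    & forall u, G u -> u.2 <= p u.1].

(** The value [c] at [x0] must lie above every [u.2 - p (u.1 - x0)] and below every
    [p (v.1 + x0) - v.2]; subadditivity of [p] puts the former numbers below the latter. *)
Lemma dominated_graph_step (G : set W) x0 : dominated_graph G ->
  exists (c : R) (B : set W), [/\ dominated_graph B, G `<=` B & B (x0, c)].
Proof.
move=> [G0 Glin Gp].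
have p0 : p 0 = 0 by rewrite -(scale0r 0) pZ // mul0r.
have GZ a u : G u -> G (a *: u) by move=> Gu; rewrite -[_ *: _]addr0; exact: Glin.
have sep u v : G u -> G v -> u.2 - p (u.1 - x0) <= p (v.1 + x0) - v.2.
  move=> Gu Gv; have := Gp _ (Glin 1 u v Gu Gv).
  rewrite scale1r /=; have := pD (u.1 - x0) (v.1 + x0).
  by rewrite addrACA addNr addr0; lra.
pose E : set R := [set u.2 - p (u.1 - x0) | u in G].
have E_sup : has_sup E.
  split; first by exists (0 - p (0 - x0)), 0.
  by exists (p (0 + x0) - 0) => _ [u Gu <-]; exact: (sep u 0).
pose c := sup E.
have c_ge u : G u -> u.2 - p (u.1 - x0) <= c.
  by move=> Gu; apply: sup_upper_bound => //; exists u.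
have c_le v : G v -> c <= p (v.1 + x0) - v.2.
  by move=> Gv; apply: ge_sup E_sup.1 _ => _ [u Gu <-]; exact: sep.
exists c, [set u | exists (t : R) (v : W), G v /\ u = v + t *: ((x0, c) : W)].
split; last 2 first.
- by move=> u Gu; exists 0, u; split => //; rewrite scale0r addr0.
- by exists 1, 0; split => //; rewrite add0r scale1r.
split.
- by exists 0, 0; split => //; rewrite scale0r addr0.
- move=> a _ _ [s [u [Gu ->]]] [t [v [Gv ->]]].
  exists (a * s + t), (a *: u + v); split; first exact: Glin.
  by rewrite scalerDr scalerDl scalerA addrACA.
move=> _ [t [v [Gv ->]]] /=.
(* Homogeneity reduces a nonzero [t] to -1 or 1, that is, to the lower or the upper bound on [c]. *)
have [t0|t0|->] := ltgtP t 0; last by rewrite !scale0r !addr0; exact: Gp.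
- have t'0 : 0 < - t by rewrite oppr_gt0.
  have := c_ge _ (GZ (- t)^-1 v Gv) => /=.
  rewrite -(ler_pM2l t'0) mulrBr -pZ ?(ltW t'0) // scalerBr scalerA.
  by rewrite divff ?gt_eqF // scale1r scaleNr opprK mulrA divff ?gt_eqF // mul1r
    -[_ *: c]/(t * c); lra.
- have := c_le _ (GZ t^-1 v Gv) => /=.
  rewrite -(ler_pM2l t0) mulrBr -pZ ?(ltW t0) // scalerDr scalerA.
  by rewrite divff ?gt_eqF // scale1r mulrA divff ?gt_eqF // mul1r
    -[_ *: c]/(t * c); lra.
Qed.

Lemma maximal_dominated_graph (G0 : set W) : dominated_graph G0 ->
  exists G, [/\ dominated_graph G, G0 `<=` G
    & forall B, dominated_graph B -> G `<=` B -> B `<=` G].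
Proof.
move=> dG0.
(* Zorn's lemma also ranges over the empty chain, whose union is empty; taking unions with [G0]
   makes that case [G0] itself. *)
have [F FP Ftot|A [dA maxA]] :=
    @Zorn_bigcup W [set A | dominated_graph (A `|` G0)].
  set U := \bigcup_(X in F) X.
  have common u v : (U `|` G0) u -> (U `|` G0) v ->
      exists Z, [/\ dominated_graph Z, Z `<=` U `|` G0, Z u & Z v].
    have sub X : F X -> X `|` G0 `<=` U `|` G0.
      by move=> FX; apply: setSU => w Xw; exists X.
    case=> [[X FX Xu]|G0u] [[Y FY Yv]|G0v].
    - have [XY|YX] := Ftot _ _ FX FY.
        exists (Y `|` G0); split; [exact: FP|exact: sub|left; exact: XY|by left].
      exists (X `|` G0); split; [exact: FP|exact: sub|by left|left; exact: YX].
    - exists (X `|` G0); split; [exact: FP|exact: sub|by left|by right].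
    - exists (Y `|` G0); split; [exact: FP|exact: sub|by right|by left].
    - by exists G0; split => // w; right.
  split; first by right; have [] := dG0.
  - move=> a u v Uu Uv; have [Z [[_ Zlin _] ZU Zu Zv]] := common _ _ Uu Uv.
    exact/ZU/Zlin.
  - by move=> u Uu; have [Z [[_ _ Zp] _ Zu _]] := common _ _ Uu Uu; exact: Zp.
exists (A `|` G0); split => // B dB AB u Bu; left; apply: contrapT => nAu.
apply: (maxA B).
  split => [w Aw|BA]; first by apply: AB; left.
  exact/nAu/BA.
rewrite /=; have -> // : B `|` G0 = B.
by apply/setUidPl => w G0w; apply: AB; right.
Qed.

Theorem hahn_banach (G0 : set W) : dominated_graph G0 ->
  exists g : V -> R^o,
    [/\ linear g, forall u, G0 u -> g u.1 = u.2 & forall x, g x <= p x].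
Proof.
move=> /maximal_dominated_graph[G [dG G0G maxG]].
have [G_0 Glin Gp] := dG.
have p0 : p 0 = 0 by rewrite -(scale0r 0) pZ // mul0r.
(* By maximality the one-step extension at [x] is already inside [G]. *)
have total x : exists r : R, G (x, r).
  have [c [B [dB GB Bx]]] := dominated_graph_step x dG.
  by exists c; exact: maxG Bx.
have G_fun x r s : G (x, r) -> G (x, s) -> r = s.
  move=> Gr Gs.
  have := Gp _ (Glin (-1) _ _ Gr Gs); have := Gp _ (Glin (-1) _ _ Gs Gr) => /=.
  by rewrite !scaleN1r !addNr p0; lra.
have [g Gg] := choice total.
exists g; split => [a x y|[x r] /G0G Gxr|x].
- exact: G_fun (Gg _) (Glin a _ _ (Gg x) (Gg y)).
- exact: G_fun (Gg _) Gxr.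
- exact: Gp (Gg x).
Qed.

End HahnBanach.

(** * Real and complex scalars *)

Section Scalars.
Variable R : realType.

Definition scalar_of_real (k : scalar_kind) : R -> scalar_field R k :=
  match k with
  | RealScalars => fun a => a
  | ComplexScalars => fun a => real_complex R a
  end.

Definition scalar_im (k : scalar_kind) : scalar_field R k -> R :=
  match k with
  | RealScalars => fun=> 0
  | ComplexScalars => fun z => complex.Im z
  end.

(* 0 for real scalars, so that every scalar z is re z + i im z. *)
Definition scalar_i (k : scalar_kind) : scalar_field R k :=
  match k with
  | RealScalars => 0
  | ComplexScalars => 'i%C
  end.

Variable k : scalar_kind.
Local Notation K := (scalar_field R k).
Local Notation re := (@scalar_re R k).
Local Notation im := (@scalar_im k).
Local Notation "a %:K" := (scalar_of_real k a) (at level 2, format "a %:K").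
Local Notation iu := (scalar_i k).

Lemma scalar_of_realD a b : (a + b)%:K = a%:K + b%:K.
Proof. by case: k => //=; exact: rmorphD. Qed.

Lemma scalar_of_realN a : (- a)%:K = - a%:K.
Proof. by case: k => //=; exact: rmorphN. Qed.

Lemma scalar_of_realM a b : (a * b)%:K = a%:K * b%:K.
Proof. by case: k => //=; exact: rmorphM. Qed.

Lemma scalar_of_real0 : 0%:K = 0.
Proof. by case: k. Qed.

Lemma scalar_of_real1 : 1%:K = 1.
Proof. by case: k. Qed.

Lemma le_scalar_of_real a b : (a%:K <= b%:K) = (a <= b).
Proof. by case: k => //=; rewrite lecR. Qed.

Lemma lt_scalar_of_real a b : (a%:K < b%:K) = (a < b).
Proof. by case: k => //=; rewrite ltcR. Qed.

Lemma scalar_of_real_inj : injective (scalar_of_real k).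
Proof. by case: k => //= a b; exact: complexI. Qed.

Lemma scalar_reK a : re a%:K = a.
Proof. by case: k. Qed.

Lemma scalar_imK a : im a%:K = 0.
Proof. by case: k. Qed.

Lemma scalar_reD z w : re (z + w) = re z + re w.
Proof. by case: k z w => //= -[a b] [c d]. Qed.

Lemma scalar_reZ a z : re (a%:K * z) = a * re z.
Proof. by case: k z => //= -[b c] /=; rewrite mul0r subr0. Qed.

Lemma scalar_reN z : re (- z) = - re z.
Proof. by case: k z => //= -[b c]. Qed.

Lemma scalar_rei z : re (iu * z) = - im z.
Proof.
by case: k z => /= [z|[b c]] /=; [rewrite mul0r oppr0|rewrite mul0r mul1r sub0r].
Qed.

Lemma scalarE z : z = (re z)%:K + iu * (im z)%:K.
Proof.
case: k z => /=; first by move=> z; rewrite mul0r addr0.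
by move=> z; exact: complexE.
Qed.

Lemma scalar_ii a : iu * (iu * a) = - a \/ iu = 0.
Proof. by case: k a => a; [right|left; rewrite mulrA -expr2 sqr_i mulN1r]. Qed.

Lemma scalar_ge0E z : 0 <= z -> z = (re z)%:K.
Proof.
case: k z => //= -[a b]; rewrite lecE /= => /andP[/eqP -> _].
by apply/eqP; rewrite eq_complex /= !eqxx.
Qed.

End Scalars.

Arguments scalar_of_real {R} k a.
Arguments scalar_i {R} k.

Section RealNorm.
Variables (R : realType) (k : scalar_kind).
Local Notation K := (scalar_field R k).
Local Notation re := (@scalar_re R k).
Local Notation im := (@scalar_im R k).
Local Notation "a %:K" := (scalar_of_real k a) (at level 2, format "a %:K").
Local Notation rabs z := (rnorm (z : K^o)).

Section Normed.
Variable V : normedModType K.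
Implicit Types x y : V.

Lemma rnormE x : `|x| = (rnorm x)%:K.
Proof. exact: scalar_ge0E. Qed.

Lemma rnorm_ge0 x : 0 <= rnorm x.
Proof. by rewrite -(le_scalar_of_real k) scalar_of_real0 -rnormE. Qed.

Lemma rnorm0 : rnorm (0 : V) = 0.
Proof. by rewrite /rnorm normr0 -(scalar_of_real0 R k) scalar_reK. Qed.

Lemma rnorm_eq0 x : rnorm x = 0 -> x = 0.
Proof. by move=> x0; apply/eqP; rewrite -normr_eq0 rnormE x0 scalar_of_real0. Qed.

Lemma rnormD x y : rnorm (x + y) <= rnorm x + rnorm y.
Proof. by rewrite -(le_scalar_of_real k) scalar_of_realD -!rnormE ler_normD. Qed.

Lemma rnormZ (z : K) x : rnorm (z *: x) = rabs z * rnorm x.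
Proof.
apply: (@scalar_of_real_inj R k).
rewrite scalar_of_realM -!rnormE normrZ; congr (_ * _); exact: scalar_ge0E.
Qed.

Lemma rnorm_sum (I : Type) (r : seq I) (F : I -> V) :
  rnorm (\sum_(i <- r) F i) <= \sum_(i <- r) rnorm (F i).
Proof.
apply: (big_ind2 (fun x a => rnorm x <= a)) => [|x a y b xa yb|//].
  by rewrite rnorm0.
exact: le_trans (rnormD x y) (lerD xa yb).
Qed.

End Normed.

Lemma rabsM z w : rabs (z * w) = rabs z * rabs w.
Proof. exact: (rnormZ z (w : K^o)). Qed.

Lemma rabsE (z : K) : rabs z = re `|z|.
Proof. by []. Qed.

Lemma rabsK a : rabs a%:K = `|a|.
Proof.
rewrite rabsE; case: k => //=.
by rewrite expr0n addr0 sqrtr_sqr.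
Qed.

Lemma rabs_re z : `|re z| <= rabs z.
Proof.
rewrite rabsE; case: k z => //= -[a b] /=; rewrite -sqrtr_sqr.
by rewrite ler_wsqrtr // lerDl sqr_ge0.
Qed.

Lemma rabs_i : rabs (scalar_i k) <= 1.
Proof.
rewrite rabsE; case: k => /=; first by rewrite normr0.
by rewrite expr0n add0r expr1n sqrtr1.
Qed.

Lemma rabs_le z : rabs z <= `|re z| + `|im z|.
Proof.
rewrite {1}[z]scalarE; apply: le_trans (rnormD (_ : K^o) (_ : K^o)) _.
rewrite rabsK lerD2l rabsM rabsK -[leRHS]mul1r ler_wpM2r ?rabs_i //.
Qed.

(** Multiplying by a phase turns bounds on real parts into bounds on absolute values. *)
Lemma rabs_phase z : exists w, rabs w = 1 /\ re (w * z) = rabs z.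
Proof.
have rabs1 : rabs 1 = 1 by rewrite -(scalar_of_real1 R k) rabsK normr1.
have [->|z0] := eqVneq z 0.
  exists 1; rewrite mulr0 (rnorm0 K^o); split => //.
  by rewrite -(scalar_of_real0 R k) scalar_reK.
exists (`|z| / z); split; last by rewrite divfK // rnormE scalar_reK.
apply: (@scalar_of_real_inj R k).
by rewrite -rnormE scalar_of_real1 normrM normfV normr_id divff // normr_eq0.
Qed.

End RealNorm.

(** * Functionals and weak norms *)

Section Realified.
Variables (R : realType) (k : scalar_kind).

(** An alias of [V] that carries the restriction of scalars to the reals beside the original
    structure. *)
Definition realified (V : lmodType (scalar_field R k)) : Type := V.

Variable V : lmodType (scalar_field R k).

HB.instance Definition _ := GRing.Zmodule.on (realified V).

Let scale (a : R) (x : realified V) : realified V := scalar_of_real k a *: (x : V).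

Let scaleA a b x : scale a (scale b x) = scale (a * b) x.
Proof. by rewrite /scale scalerA scalar_of_realM. Qed.

Let scale1 : left_id 1 scale.
Proof. by move=> x; rewrite /scale scalar_of_real1 scale1r. Qed.

Let scaleDr : right_distributive scale +%R.
Proof. by move=> a x y; rewrite /scale scalerDr. Qed.

Let scaleDl x : {morph scale^~ x : a b / a + b}.
Proof. by move=> a b; rewrite /scale scalar_of_realD scalerDl. Qed.

HB.instance Definition _ := GRing.Zmodule_isLmodule.Build R (realified V)
  scaleA scale1 scaleDr scaleDl.

Lemma realified_scaleE (a : R) (x : realified V) :
  a *: x = scalar_of_real k a *: (x : V) :> V.
Proof. by []. Qed.

End Realified.

Section ScalarHahnBanach.
Variables (R : realType) (k : scalar_kind).
Local Notation K := (scalar_field R k).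
Local Notation re := (@scalar_re R k).
Local Notation "a %:K" := (scalar_of_real k a) (at level 2, format "a %:K").
Local Notation iu := (scalar_i k).
Variable V : normedModType K.

(* A real functional g is the real part of the K-linear functional
   x |-> g x - i g (i x). *)
Lemma hahn_banach_scalar (b : R) (G : set (realified V * R^o)) : 0 <= b ->
  dominated_graph (fun x : realified V => b * rnorm (x : V)) G ->
  exists phi : {linear V -> K^o},
    (forall u, G u -> re (phi u.1) = u.2) /\
    forall x, rnorm (phi x) <= b * rnorm x.
Proof.
move=> b0 dG.
have pD (x y : realified V) : b * rnorm (x + y : V) <= b * rnorm (x : V) + b * rnorm (y : V).
  by rewrite -mulrDr ler_wpM2l // rnormD.
have pZ a (x : realified V) : 0 <= a ->
    b * rnorm ((a *: x) : V) = a * (b * rnorm (x : V)).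
  by move=> a0; rewrite realified_scaleE rnormZ rabsK ger0_norm // mulrCA.
have [g [glin gG g_le]] := hahn_banach pD pZ dG.
have gD (x y : V) : g (x + y) = g x + g y.
  by have := glin 1 x y; rewrite !scale1r.
have g0 : g (0 : V) = 0.
  by apply: (addrI (g (0 : V))); rewrite -gD !addr0.
have gZ a (x : V) : g (a%:K *: x) = a * g x.
  by have := glin a x 0; rewrite addr0 realified_scaleE g0 addr0.
pose phi (x : V) : K^o := (g x)%:K - iu * (g (iu *: x))%:K.
have phiD x y : phi (x + y) = phi x + phi y.
  rewrite /phi scalerDr !gD !scalar_of_realD mulrDr opprD; exact: addrACA.
have phiZr a x : phi (a%:K *: x) = a%:K * phi x.
  rewrite /phi scalerA (mulrC iu a%:K) -scalerA !gZ !scalar_of_realM mulrBr.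
  by rewrite (mulrCA iu).
(* Commuting with [iu] upgrades real linearity to linearity over the scalars. For real scalars [iu]
   is 0 and both sides vanish. *)
have phi_i x : phi (iu *: x) = iu * phi x.
  have [ii|i0] := @scalar_ii R k 1; last first.
    by rewrite /phi i0 !mul0r !scale0r !g0 scalar_of_real0 subr0.
  have {}ii : iu * iu = -1 :> K by rewrite -ii mulr1.
  rewrite /phi scalerA ii scaleN1r mulrBr mulrA ii mulN1r opprK.
  have -> : g (- x) = - g x.
    by apply/eqP; rewrite -addr_eq0 -gD addNr g0.
  by rewrite scalar_of_realN mulrN opprK addrC.
have phi_lin : linear phi.
  move=> a x y; rewrite phiD; congr (_ + _).
  rewrite [a in LHS]scalarE scalerDl phiD -scalerA phi_i !phiZr mulrA -mulrDl.
  by rewrite -scalarE.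
have re_phi x : re (phi x) = g x.
  by rewrite /phi scalar_reD scalar_reK scalar_reN scalar_rei scalar_imK !oppr0 addr0.
pose Phi := GRing.isLinear.Build K V K^o _ phi phi_lin.
pose Phi' : {linear V -> K^o} := HB.pack phi Phi.
exists Phi'; split => [u Gu|x]; first by rewrite -(gG _ Gu) -re_phi.
(* A phase [w] gives [|phi x| = re (phi (w x)) = g (w x)], and [w x] has the norm of [x]. *)
rewrite /=; have [w [w1 <-]] := rabs_phase (phi x : K).
rewrite -[w * _]/(w *: (Phi' x)) -linearZ /= re_phi.
by apply: le_trans (g_le _) _; rewrite rnormZ w1 mul1r.
Qed.

(** Extend [t x |-> t |x|] from the real multiples of [x]. *)
Lemma norming_functional (x : V) : exists phi : {linear V -> K^o},
  rnorm x <= rnorm (phi x) /\ forall y, rnorm (phi y) <= rnorm y.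
Proof.
pose G : set (realified V * R^o) :=
  [set u | exists t : R, u = (t%:K *: x, t * rnorm x)].
have dG : dominated_graph (fun x : realified V => 1 * rnorm (x : V)) G.
  split.
  - by exists 0; rewrite scalar_of_real0 scale0r mul0r.
  - move=> a _ _ [s ->] [t ->]; exists (a * s + t).
    congr (_, _); last by rewrite mulrDl -mulrA.
    by rewrite /= realified_scaleE scalerA scalar_of_realD scalerDl scalar_of_realM.
  - move=> _ [t ->] /=.
    by rewrite mul1r rnormZ rabsK ler_wpM2r ?rnorm_ge0 // ler_norm.
have [phi [phiG phi_le]] := hahn_banach_scalar ler01 dG.
exists phi; split=> [|y]; last by rewrite -[leRHS]mul1r.
have := phiG (x, rnorm x); rewrite /= => <-.
  exact: le_trans (ler_norm _) (rabs_re _).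
by exists 1; rewrite scalar_of_real1 scale1r mul1r.
Qed.

End ScalarHahnBanach.

Section WeakNorm.
Variables (R : realType) (k : scalar_kind).
Local Notation K := (scalar_field R k).
Local Notation "a %:K" := (scalar_of_real k a) (at level 2, format "a %:K").

(** Homogeneity is stated on [F] alone so that the lemma applies to the inverse [S] in
    [banach_mazur], which is arbitrary off [F]. *)
Lemma opnorm_le (V W : normedModType K) (F : set V) (f : V -> W) (c : R) x :
  (forall a x, F x -> F (a%:K *: x)) ->
  (forall a x, F x -> f (a%:K *: x) = a%:K *: f x) ->
  (opnorm F f <= c%:E)%E -> F x -> rnorm (f x) <= c * rnorm x.
Proof.
move=> FZ fZ f_le Fx.
have [x0|x0] := eqVneq (rnorm x) 0.
  have -> : f x = 0.
    rewrite (rnorm_eq0 x0) -(scale0r 0) -(scalar_of_real0 R k) fZ.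
      by rewrite scalar_of_real0 scale0r.
    by rewrite -(rnorm_eq0 x0).
  by rewrite rnorm0 x0 mulr0.
have x_gt0 : 0 < rnorm x by rewrite lt_neqAle eq_sym x0 rnorm_ge0.
have : ((rnorm (f ((rnorm x)^-1%:K *: x)))%:E <= c%:E)%E.
  apply: le_trans f_le; apply: ereal_sup_ubound.
  exists ((rnorm x)^-1%:K *: x) => //; split; first exact: FZ.
  by rewrite /= rnormZ rabsK ger0_norm ?invr_ge0 ?rnorm_ge0 // mulVf.
rewrite lee_fin fZ // rnormZ rabsK ger0_norm ?invr_ge0 ?rnorm_ge0 //.
by rewrite ler_pdivrMl // mulrC.
Qed.

Variable V : normedModType K.

Lemma dual_ballP (phi : {linear V -> K^o}) :
  dual_ball phi <-> forall x, rnorm (phi x) <= rnorm x.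
Proof.
split => [[_ phi1] x|phi_le].
  rewrite -[leRHS]mul1r; apply: opnorm_le phi1 _ => // a y _.
  by rewrite linearZ.
split.
  apply: bounded_linear_continuous; apply/bounded_funP => r; exists r => x.
  by apply: le_trans; rewrite !rnormE le_scalar_of_real.
apply: ge_ereal_sup => _ [x [_ x1] <-]; rewrite lee_fin.
exact: le_trans (phi_le x) x1.
Qed.

Lemma dual_ball0 : dual_ball (\0 : {linear V -> K^o}).
Proof. by apply/dual_ballP => x; rewrite /= rnorm0 rnorm_ge0. Qed.

Variables (q : R) (m : nat) (x : 'I_m -> V).
Hypothesis q_gt0 : 0 < q.

Lemma weak_norm_ub (phi : {linear V -> K^o}) : dual_ball phi ->
  (\sum_(j < m) rnorm (phi (x j)) `^ q) `^ q^-1 <= weak_norm q x.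
Proof.
move=> phi1; apply: ub_le_sup; last by exists phi.
exists ((\sum_(j < m) rnorm (x j) `^ q) `^ q^-1) => _ [psi /dual_ballP psi1 <-].
apply: ge0_ler_powR; rewrite ?invr_ge0 ?(ltW q_gt0) // ?nnegrE.
- by apply: sumr_ge0 => j _; exact: powR_ge0.
- by apply: sumr_ge0 => j _; exact: powR_ge0.
apply: ler_sum => j _; apply: ge0_ler_powR; rewrite ?(ltW q_gt0) //.
- by rewrite nnegrE rnorm_ge0.
- by rewrite nnegrE rnorm_ge0.
Qed.

Lemma weak_norm_ge0 : 0 <= weak_norm q x.
Proof. exact: le_trans (powR_ge0 _ _) (weak_norm_ub dual_ball0). Qed.

(** Dividing [phi] by [b] brings it into the dual ball; for [b = 0] it vanishes. *)
Lemma sum_functional_le (b : R) (phi : {linear V -> K^o}) : 0 <= b ->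
  (forall y, rnorm (phi y) <= b * rnorm y) ->
  \sum_(j < m) rnorm (phi (x j)) `^ q <= (b * weak_norm q x) `^ q.
Proof.
move=> b0 phi_le.
have q_neq0 : q != 0 by rewrite gt_eqF.
have [bz|b_neq0] := eqVneq b 0.
  rewrite big1 ?powR_ge0 // => j _.
  have -> : rnorm (phi (x j)) = 0.
    by apply/le_anti; rewrite rnorm_ge0 andbT; have := phi_le (x j); rewrite bz mul0r.
  by rewrite powR0.
have b_gt0 : 0 < b by rewrite lt_neqAle eq_sym b_neq0.
pose psi : {linear V -> K^o} := b^-1%:K \*: phi.
have psiE y : rnorm (psi y) = b^-1 * rnorm (phi y).
  by rewrite /psi /= rnormZ rabsK ger0_norm // invr_ge0.
have psi1 : dual_ball psi.
  by apply/dual_ballP => y; rewrite psiE ler_pdivrMl.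
have := weak_norm_ub psi1.
set S := \sum_(j < m) _ => Sw.
have S0 : 0 <= S by apply: sumr_ge0 => j _; exact: powR_ge0.
have -> : \sum_(j < m) rnorm (phi (x j)) `^ q = b `^ q * S.
  rewrite mulr_sumr; apply: eq_bigr => j _; rewrite psiE -powRM //.
  - by rewrite mulrA divff // mul1r.
  - by rewrite mulr_ge0 ?rnorm_ge0 // invr_ge0.
rewrite powRM ?weak_norm_ge0 // ler_wpM2l ?powR_ge0 //.
have -> : S = (S `^ q^-1) `^ q by rewrite -powRrM mulVf // powRr1.
by apply: ge0_ler_powR; rewrite ?(ltW q_gt0) // nnegrE ?powR_ge0 ?weak_norm_ge0.
Qed.

End WeakNorm.

(** * Factorization through finite-dimensional l_infty *)

Section LInfty.
Variables (R : realType) (k : scalar_kind).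
Local Notation K := (scalar_field R k).
Local Notation re := (@scalar_re R k).
Local Notation im := (@scalar_im R k).
Local Notation "a %:K" := (scalar_of_real k a) (at level 2, format "a %:K").
Local Notation iu := (scalar_i k).
Local Notation rabs z := (rnorm (z : K^o)).

Lemma rabs_entry_le (m : nat) (w : 'rV[K]_m) l : rabs (w 0 l) <= rnorm w.
Proof.
rewrite -(le_scalar_of_real k) -!rnormE [leRHS]/Num.norm /= mx_normE.
have : `|w 0 l|%:nng <= \big[Num.max/0%:nng]_i `|w i.1 i.2|%:nng.
  by apply/bigmax_geP; right; exists (0, l).
by rewrite -num_le.
Qed.

Lemma rnorm_row_le (m : nat) (w : 'rV[K]_m) c : 0 <= c ->
  (forall l, rabs (w 0 l) <= c) -> rnorm w <= c.
Proof.
move=> c0 wc; have [w0|w0] := eqVneq (mx_norm w) 0.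
  by rewrite (mx_norm_eq0 w0) rnorm0.
have [[i l] /= e] := mx_norm_neq0 w0.
apply: le_trans (wc l); rewrite -(le_scalar_of_real k) -!rnormE.
by rewrite [leLHS]/Num.norm /= e ord1.
Qed.

(** Doubling the index set lets a real l_infty space parametrize scalar vectors: [true] marks real
    parts, [false] imaginary parts. This costs a factor 2 in norm. *)
Definition complexify (I : Type) (v : I * bool -> R) (l : I) : K :=
  (v (l, true))%:K + iu * (v (l, false))%:K.

Lemma complexify_linear (I : Type) a (v w : I * bool -> R) l :
  complexify (fun i => a * v i + w i) l = a%:K * complexify v l + complexify w l.
Proof. by rewrite /complexify !scalar_of_realD !scalar_of_realM; ring. Qed.

Lemma rabs_complexify (I : Type) (v : I * bool -> R) l :
  (forall i, `|v i| <= 1) -> rabs (complexify v l) <= 2.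
Proof.
move=> v1; apply: le_trans (rnormD (_ : K^o) (_ : K^o)) _.
rewrite rabsM !rabsK; have := v1 (l, true); have := v1 (l, false).
have := @rabs_i R k; have := normr_ge0 (v (l, false)).
have := rnorm_ge0 (iu : K^o); nra.
Qed.

(* The index set I can be any large enough finite type, so that all the spaces
   X_i can be factored through the same one. *)
Definition linfty_factorization (V : normedModType K) (q : R) :=
  exists L : R, 0 <= L /\ forall (m : nat) (x : 'I_m -> V),
    exists N : nat, forall (I : finType), (N <= #|I|)%N ->
    exists (T : (I -> R) -> V) (z : 'I_m -> I -> R),
    [/\ forall a v w, T (fun i => a * v i + w i) = a%:K *: T v + T w,
        forall j, T (z j) = x j,
        forall v, (forall i, `|v i| <= 1) -> rnorm (T v) <= L * weak_norm q x
      & forall i, \sum_j z j i ^+ 2 <= 1].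

(** [I] embeds into any [J] at least as large; [T] reads [v] through the embedding and the [z j] are
    extended by zero. *)
Lemma linfty_factorizationI (V : normedModType K) (q L : R) : 0 <= L ->
  (forall (m : nat) (x : 'I_m -> V), exists (I : finType)
     (T : (I -> R) -> V) (z : 'I_m -> I -> R),
    [/\ forall a v w, T (fun i => a * v i + w i) = a%:K *: T v + T w,
        forall j, T (z j) = x j,
        forall v, (forall i, `|v i| <= 1) -> rnorm (T v) <= L * weak_norm q x
      & forall i, \sum_j z j i ^+ 2 <= 1]) ->
  linfty_factorization V q.
Proof.
move=> L0 fact; exists L; split => // m x.
have [I [T [z [Tlin Tz Tle zle]]]] := fact m x; exists #|I| => J leIJ.
pose e (i : I) : J := enum_val (widen_ord leIJ (enum_rank i)).
have e_inj : injective e.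
  by move=> i i' /enum_val_inj/(congr1 val)/= /val_inj/enum_rank_inj.
exists (fun v => T (v \o e)).
exists (fun j l => if [pick i | e i == l] is Some i then z j i else 0).
split => [a v w|j|v v1|l].
- exact: Tlin.
- rewrite -Tz; congr T; apply/funext => i /=.
  by case: pickP => [i' /eqP/e_inj -> //|/(_ i)]; rewrite eqxx.
- by apply: Tle => i; exact: v1.
- case: pickP => [i _|_]; first exact: zle.
  by rewrite big1 ?ler01 // => j _; rewrite expr0n.
Qed.

(** [T] sends the unit vectors to the [x j]. A norming functional [phi] of [T v] gives
    [|T v| <= 2 sum_j |phi (x j)|], which the weak 1-norm controls. *)
Lemma linfty_factorization1 (V : normedModType K) : linfty_factorization V 1.
Proof.
apply: (@linfty_factorizationI V 1 2) => // m x.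
exists ('I_m * bool)%type, (fun v => \sum_(j < m) complexify v j *: x j).
exists (fun j l => ((l.1 == j) && l.2)%:R); split => [a v w|j|v v1|[l b]].
- rewrite scaler_sumr -big_split; apply: eq_bigr => j _ /=.
  by rewrite complexify_linear scalerDl scalerA.
- rewrite (bigD1 j) //= /complexify /= eqxx big1 => [|i /negbTE ->] /=.
    by rewrite scalar_of_real1 scalar_of_real0 mulr0 !addr0 scale1r.
  by rewrite scalar_of_real0 mulr0 addr0 scale0r.
- set y := \sum_(j < m) _.
  have [phi [y_le phi_le]] := norming_functional y; apply: le_trans y_le _.
  have phi1 : \sum_(j < m) rnorm (phi (x j)) `^ 1 <= (1 * weak_norm 1 x) `^ 1.
    by apply: sum_functional_le => // z; rewrite mul1r.
  rewrite powRr1 mul1r ?weak_norm_ge0 // in phi1.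
  rewrite linear_sum; apply: le_trans (rnorm_sum _ _) _.
  apply: le_trans (_ : \sum_(j < m) 2 * rnorm (phi (x j)) <= _).
    apply: ler_sum => j _; rewrite linearZ rnormZ.
    by rewrite ler_wpM2r ?rnorm_ge0 // rabs_complexify.
  rewrite -mulr_sumr ler_wpM2l //; apply: le_trans phi1; apply: ler_sum => j _.
  by rewrite powRr1 // rnorm_ge0.
- case: b => /=; last by rewrite big1 // => j _; rewrite andbF expr0n.
  rewrite (bigD1 l) //= eqxx big1 ?addr0 ?expr1n // => j.
  by rewrite eq_sym => /negbTE ->; rewrite expr0n.
Qed.

Lemma Linfty_lambda_embedding (V : normedModType K) (lambda : R) (m : nat)
    (x : 'I_m -> V) : Linfty_lambda_space V lambda ->
  exists (d : nat) (T : {linear 'rV[K]_d -> V}) (a b : R),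
  [/\ 0 <= a /\ 0 <= b, a * b <= lambda + 1,
      forall w, rnorm (T w) <= a * rnorm w,
      forall w, rnorm w <= b * rnorm (T w) & forall j, exists w, T w = x j].
Proof.
move=> /(_ (range (fun a : 'I_m -> K => \sum_(i < m) a i *: x i))).
case; first by exists m, x.
move=> F [d [_ EF BM]].
(* The infimum need not be attained; the slack 1 yields an actual pair of maps. *)
have /ereal_inf_lt[D [T [S [TF TS ->]]]] :
    (banach_mazur 'rV[K]_d F < (lambda + 1)%:E)%E.
  by apply: le_lt_trans BM _; rewrite lte_fin ltrDl.
set P := opnorm setT T; set Q := opnorm F S => PQ.
have Tx j : exists w, T w = x j.
  have /EF : range (fun a : 'I_m -> K => \sum_(i < m) a i *: x i) (x j).
    exists (fun i => (i == j)%:R) => //; rewrite (bigD1 j) //= eqxx scale1r.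
    by rewrite big1 ?addr0 // => i /negbTE ->; rewrite scale0r.
  by rewrite -TF => -[w _ <-]; exists w.
have F_T w : F (T w) by rewrite -TF; exists w.
have FZ a y : F y -> F (a%:K *: y).
  by rewrite -{1}TF => -[w _ <-]; rewrite -linearZ.
have SZ a y : F y -> S (a%:K *: y) = a%:K *: S y.
  by rewrite -TF => -[w _ <-]; rewrite -linearZ !TS.
have P_le a w : (P <= a%:E)%E -> rnorm (T w) <= a * rnorm w.
  by move=> Pa; apply: opnorm_le Pa _ => // c y _; rewrite linearZ.
have Q_le b w : (Q <= b%:E)%E -> rnorm w <= b * rnorm (T w).
  by move=> Qb; rewrite -{1}(TS w); apply: opnorm_le Qb _.
have P0 : (0 <= P)%E.
  apply: ereal_sup_ubound; exists 0; last by rewrite linear0 rnorm0.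
  by split => //=; rewrite rnorm0.
have Q0 : (0 <= Q)%E.
  apply: ereal_sup_ubound; exists (T 0); last by rewrite TS rnorm0.
  by split => //=; rewrite linear0 rnorm0.
(* In the extended reals 0 times +oo is 0, so a finite product does not make both norms finite when
   one is 0. In that case the row space is zero, and [a = b = 0] will do. *)
have trivial : (forall w : 'rV[K]_d, w = 0) -> lambda + 1 >= 0 -> exists (a b : R),
    [/\ 0 <= a /\ 0 <= b, a * b <= lambda + 1,
      forall w, rnorm (T w) <= a * rnorm w & forall w, rnorm w <= b * rnorm (T w)].
  move=> w0 l0; exists 0, 0; split; rewrite ?mul0r // => w; rewrite mul0r (w0 w).
    by rewrite linear0 rnorm0.
  by rewrite rnorm0.
have l0 : 0 <= lambda + 1.
  by rewrite -lee_fin; apply: le_trans (ltW PQ); exact: mule_ge0.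
suff [a [b [ab0 ab Ta Tb]]] : exists (a b : R),
    [/\ 0 <= a /\ 0 <= b, a * b <= lambda + 1,
      forall w, rnorm (T w) <= a * rnorm w & forall w, rnorm w <= b * rnorm (T w)].
  by exists d, T, a, b.
have [Pz|P_neq0] := eqVneq P 0%E.
  apply: trivial => // w; rewrite -(TS w) -(TS 0) linear0; congr S.
  apply: rnorm_eq0; apply/le_anti; rewrite rnorm_ge0 andbT.
  by have := P_le 0 w; rewrite Pz mul0r; apply.
have [Qz|Q_neq0] := eqVneq Q 0%E.
  apply: trivial => // w; apply: rnorm_eq0; apply/le_anti; rewrite rnorm_ge0 andbT.
  by have := Q_le 0 w; rewrite Qz mul0r; apply.
have P_gt0 : (0 < P)%E by rewrite lt_neqAle eq_sym P_neq0.
have Q_gt0 : (0 < Q)%E by rewrite lt_neqAle eq_sym Q_neq0.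
case: P Q P_gt0 Q_gt0 PQ P_le Q_le {P0 Q0 P_neq0 Q_neq0} => [a| |//] [b| |//].
- rewrite !lte_fin => a0 b0 ab Ta Tb; exists a, b; split.
  + by split; exact: ltW.
  + exact: ltW.
  + by move=> w; exact: Ta.
  + by move=> w; exact: Tb.
- by move=> a0 _; rewrite gt0_muley.
- by move=> _ b0; rewrite gt0_mulye.
- by [].
Qed.

Lemma linfty_factorization2 (V : normedModType K) :
  infinite_dim_Linfty_space V -> linfty_factorization V 2.
Proof.
move=> [_ [lambda [lambda1 XL]]].
have L0 : 0 <= 2 * (lambda + 1) by lra.
apply: (linfty_factorizationI L0) => m x.
have [d [T [a [b [[a0 b0] ab Ta Tb /choice[z Tz]]]]]] := Linfty_lambda_embedding x XL.
set w := weak_norm 2 x; have w0 : 0 <= w by exact: weak_norm_ge0.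
(* The functional [T v |-> re (c v_l)] is dominated by [b] times the norm on the range of [T]; its
   extension by Hahn-Banach is tested against the weak 2-norm. The choices [c = 1] and [c = iu] give
   real and imaginary parts. *)
have sum_z (c : K) l : rabs c <= 1 ->
    \sum_j re (c * z j 0 l) ^+ 2 <= (b * w) ^+ 2.
  move=> c1.
  pose G : set (realified V * R^o) :=
    [set u | exists v, u = (T v, re (c * v 0 l))].
  have dG : dominated_graph (fun x : realified V => b * rnorm (x : V)) G.
    split.
    - exists 0; congr (_, _); first by rewrite linear0.
      by rewrite mxE mulr0 -(scalar_of_real0 R k) scalar_reK.
    - move=> t _ _ [v ->] [v' ->]; exists (t%:K *: v + v'); congr (_, _).
        by rewrite linearP.
      by rewrite !mxE mulrDr scalar_reD mulrCA scalar_reZ.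
    - move=> _ [v ->] /=; apply: le_trans (ler_norm _) _.
      apply: le_trans (rabs_re _) _; rewrite rabsM; apply: le_trans (Tb v).
      apply: le_trans (rabs_entry_le v l); by rewrite ler_piMl ?rnorm_ge0.
  have [phi [phiG phi_le]] := hahn_banach_scalar b0 dG.
  apply: le_trans (_ : \sum_j rnorm (phi (x j)) `^ 2 <= _).
    apply: ler_sum => j _; rewrite powR_mulrn ?rnorm_ge0 //.
    rewrite -Tz -[re _ in leLHS](phiG (T (z j), _)); last by exists (z j).
    rewrite -[leLHS]real_normK ?num_real // lerXn2r ?nnegrE ?rnorm_ge0 //.
    exact: rabs_re.
  rewrite -powR_mulrn ?mulr_ge0 //; exact: sum_functional_le.
(* The factor [beta] moves from the coordinates to the map, whose bound becomes
   [2 a b w <= 2 (lambda + 1) w]. *)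
set beta := b * w; have beta0 : 0 <= beta by exact: mulr_ge0.
exists ('I_d * bool)%type.
exists (fun v => T (beta%:K *: \row_l complexify v l)).
exists (fun j l => (if l.2 then re (z j 0 l.1) else im (z j 0 l.1)) / beta).
have sum_re l : \sum_j re (z j 0 l) ^+ 2 <= beta ^+ 2.
  under eq_bigr do rewrite -[z _ _ _]mul1r.
  by apply: sum_z; rewrite -(scalar_of_real1 R k) rabsK normr1.
have sum_im l : \sum_j im (z j 0 l) ^+ 2 <= beta ^+ 2.
  under eq_bigr do rewrite -sqrrN -scalar_rei.
  by apply: sum_z; exact: rabs_i.
(* If [beta] is 0 all the coordinates are 0, so dividing by [beta] loses nothing. *)
have vanish (y : 'I_m -> R) : beta = 0 -> \sum_j y j ^+ 2 <= beta ^+ 2 ->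
    forall j, y j = 0.
  move=> -> ; rewrite expr0n /= => y0 j; apply/eqP; rewrite -sqrf_eq0.
  apply/eqP/le_anti; rewrite sqr_ge0 andbT; apply: le_trans y0.
  by rewrite (bigD1 j) //= lerDl sumr_ge0 // => i _; exact: sqr_ge0.
split => [c v v'|j|v v1|[l []] /=].
- rewrite -linearP; congr (T _); apply/rowP => l.
  by rewrite !mxE complexify_linear; ring.
- rewrite -Tz; congr (T _); apply/rowP => l; rewrite !mxE /complexify /=.
  rewrite mulrDr mulrCA -!scalar_of_realM.
  have divK (y : 'I_m -> R) : \sum_j y j ^+ 2 <= beta ^+ 2 ->
      beta * (y j / beta) = y j.
    move=> ysum; have [bz|b_neq0] := eqVneq beta 0.
      by rewrite (vanish y bz ysum) mul0r mulr0.
    by rewrite mulrC divfK.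
  by rewrite (divK _ (sum_re l)) (divK _ (sum_im l)) -scalarE.
- apply: le_trans (Ta _) _; rewrite rnormZ rabsK (ger0_norm beta0).
  have : rnorm (\row_l complexify v l : 'rV[K]_d) <= 2.
    by apply: rnorm_row_le => // l; rewrite mxE rabs_complexify.
  have := rnorm_ge0 (\row_l complexify v l : 'rV[K]_d).
  move: (rnorm _) => r r0 r2; rewrite /beta.
  have -> : a * (b * w * r) = (a * b) * (w * r) by ring.
  apply: le_trans (_ : (lambda + 1) * (w * r) <= _).
    by rewrite ler_wpM2r // mulr_ge0.
  have -> : 2 * (lambda + 1) * w = (lambda + 1) * (w * 2) by ring.
  by rewrite ler_wpM2l ?ler_wpM2l //; lra.
all: have [bz|b_neq0] := eqVneq beta 0;
  first by rewrite big1 // => j _; rewrite bz invr0 mulr0 expr0n.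
all: under eq_bigr do rewrite exprMn.
all: by rewrite -mulr_suml exprVn ler_pdivrMr ?mul1r ?sum_re ?sum_im //
  exprn_gt0 // lt_neqAle eq_sym b_neq0.
Qed.

End LInfty.

(** * Multilinear forms on normed spaces *)

Section Multilinear.
Variables (R : realType) (k : scalar_kind).
Local Notation K := (scalar_field R k).
Local Notation re := (@scalar_re R k).
Local Notation im := (@scalar_im R k).
Local Notation "a %:K" := (scalar_of_real k a) (at level 2, format "a %:K").
Local Notation iu := (scalar_i k).
Local Notation rabs z := (rnorm (z : K^o)).
Variables (n : nat) (X : 'I_n -> normedModType K) (A : (forall i, X i) -> K).

(** The factor [c] selects what is seen of [A]: 1 for the real part, [iu] for the imaginary part up
    to sign, a phase for the absolute value. *)
Lemma real_multilinear_comp (I : finType) (T : forall i, (I -> R) -> X i) (c : K) :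
  multilinear A ->
  (forall i a v w, T i (fun l => a * v l + w l) = a%:K *: T i v + T i w) ->
  real_multilinear (fun v => re (c * A (fun i => T i (v i)))).
Proof.
move=> Alin Tlin v j a f g.
have TdE h : (fun i => T i (dfwith v j h i)) = dfwith (fun i => T i (v i)) j (T j h).
  by apply: functional_extensionality_dep => i;
    case: (eqVneq j i) => [<-|ne]; rewrite ?dfwithin // !dfwithout.
rewrite !TdE Tlin; have := Alin j (fun i => T i (v i)) a%:K (T j f) (T j g).
move=> ->; rewrite -scalar_reZ -scalar_reD; congr re.
by rewrite mulrDr; congr (_ + _); exact: mulrCA.
Qed.

(** The sets containing a box around 0 form a filter, and its convergence to 0 in the product
    topology can be checked coordinate by coordinate. *)
Lemma nbhs_prod_box (U : set (prod_topology X)) :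
  nbhs ((fun i => 0) : prod_topology X) U ->
  exists2 e : R, 0 < e & forall x, (forall i, rnorm (x i) <= e) -> U x.
Proof.
pose F : set_system (prod_topology X) :=
  [set U | exists2 e : R, 0 < e & forall x, (forall i, rnorm (x i) <= e) -> U x].
have FF : Filter F.
  split.
  - by exists 1.
  - move=> P Q [d d0 dP] [e e0 eQ]; exists (Num.min d e).
      by rewrite lt_min d0.
    by move=> x x_le; split; [apply: dP|apply: eQ] => i;
      have := x_le i; rewrite le_min => /andP[].
  - by move=> P Q PQ [e e0 eP]; exists e => // x /eP/PQ.
suff : F --> ((fun i => 0) : prod_topology X) by apply.
apply/cvg_sup => i B /=.
rewrite (@nbhsE (initial_topology (fun f : (forall i, X i) => f i))) => -[_ [[C oC <-] C0] CB].
have : nbhs (0 : X i) C by apply: open_nbhs_nbhs.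
move=> /nbhs_normP[e /= e0 eC].
have ee : e = (re e)%:K by apply: scalar_ge0E; exact: ltW.
have re0 : 0 < re e by rewrite -(lt_scalar_of_real k) -ee scalar_of_real0.
(* Halving the radius puts the closed box inside the open ball. *)
exists (re e / 2) => [|x x_le]; first by rewrite divr_gt0.
apply: CB; apply: eC; rewrite /ball_ /= sub0r normrN rnormE ee lt_scalar_of_real.
by apply: le_lt_trans (x_le i) _; rewrite ltr_pdivrMr // ltr_pMr // ltr1n.
Qed.

Lemma continuous_multilinear_bounded : (0 < n)%N -> continuous_multilinear A ->
  exists C : R, 0 <= C /\ forall x, rabs (A x) <= C * \prod_i rnorm (x i).
Proof.
move=> n0 [Alin Acont].
have A_zero x i : x i = 0 -> A x = 0.
  move=> xi0; have := Alin i x 1 0 0.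
  have dx : dfwith x i 0 = x.
    apply: functional_extensionality_dep => j.
    by case: (eqVneq i j) => [<-|ne]; rewrite ?dfwithin // dfwithout.
  rewrite scaler0 addr0 dx scale1r => /eqP.
  by rewrite -subr_eq0 opprD addNKr oppr_eq0 => /eqP.
have [e e0 eA] : exists2 e : R, 0 < e &
    forall x, (forall i, rnorm (x i) <= e) -> rabs (A x) <= 1.
  apply: (@nbhs_prod_box [set x | rabs (A x) <= 1]).
  have := Acont (fun=> 0); rewrite /continuous_at /=.
  rewrite (A_zero _ (Ordinal n0)) // => /(@cvgr0_norm_le _ K^o) /(_ 1 ltr01).
  apply: filterS => x /=.
  by rewrite -(scalar_of_real1 R k) rnormE le_scalar_of_real.
exists (e^-1 ^+ n); split => [|x]; first by rewrite exprn_ge0 // invr_ge0 ltW.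
have [/existsP[i /eqP xi0]|x_neq0] := boolP [exists i, rnorm (x i) == 0].
  rewrite (A_zero x i) ?(rnorm_eq0 xi0) // rnorm0 mulr_ge0 //.
    by rewrite exprn_ge0 // invr_ge0 ltW.
  by apply: prodr_ge0 => j _; exact: rnorm_ge0.
have x_gt0 i : 0 < rnorm (x i).
  rewrite lt_neqAle rnorm_ge0 andbT eq_sym.
  by apply: contra x_neq0 => xi0; apply/existsP; exists i.
have [c [c1 cA]] := rabs_phase (A x).
(* A one-point index set turns scaling of the [x i] into [multilinear_scale]; every vector is scaled
   to norm [e], whence the constant [e^-1 ^+ n]. *)
pose T i (v : unit -> R) : X i := (v tt)%:K *: x i.
have Tlin i a v w : T i (fun l => a * v l + w l) = a%:K *: T i v + T i w.
  by rewrite /T scalar_of_realD scalar_of_realM scalerDl scalerA.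
have Blin := real_multilinear_comp c Alin Tlin.
have := multilinear_scale Blin (fun i => e / rnorm (x i)) (fun _ _ => 1).
have -> : (fun i => T i (fun=> 1)) = x.
  by apply: functional_extensionality_dep => i; rewrite /T scalar_of_real1 scale1r.
rewrite cA /= => Ee.
have e_gt0 i : 0 < e / rnorm (x i) by rewrite divr_gt0.
have : \prod_i (e / rnorm (x i)) * rabs (A x) <= 1.
  rewrite -Ee; apply: le_trans (ler_norm _) _; apply: le_trans (rabs_re _) _.
  rewrite rabsM c1 mul1r; apply: eA => i.
  rewrite /T mulr1 rnormZ rabsK ger0_norm ?divfK ?gt_eqF //.
  exact: ltW.
rewrite -ler_pdivlMl ?prodr_gt0 // mulr1 => /le_trans; apply.
rewrite -prodfV big_mkcond /= -[n in e^-1 ^+ n]card_ord -prodr_const -big_split /=.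
by rewrite le_eqVlt; apply/orP; left; apply/eqP; apply: eq_bigr => i _;
  rewrite invf_div mulrC.
Qed.

End Multilinear.

(** Composed with the maps [T i], the real parts of [A] and of [iu A] become real forms on l_infty,
    to which [multilinear_grothendieck] applies with the [z i] as vectors. Adding the two estimates
    gives the factor 2. *)
Theorem factorization_summing (R : realType) (k : scalar_kind) (n : nat)
    (X : 'I_n.+2 -> normedModType (scalar_field R k)) (q : 'I_n.+2 -> R)
    (A : (forall i, X i) -> scalar_field R k) :
  (forall i, 0 < q i) -> (forall i, linfty_factorization (X i) (q i)) ->
  continuous_multilinear A -> absolutely_summing 1 q A.
Proof.
move=> q_gt0 factX A_cm; split=> //.
have [Alin _] := A_cm.
have [C [C0 A_le]] := continuous_multilinear_bounded (ltn0Sn _) A_cm.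
have [L XL] := choice factX.
pose c : R := 2 * n.+2%:R ^+ n.+2.
exists (2 * c * C * \prod_i L i); split.
  have prodL : 0 <= \prod_i L i by apply: prodr_ge0 => i _; have [] := XL i.
  by rewrite /c; do !(apply: mulr_ge0 => //); exact: exprn_ge0.
move=> m x; pose w i := weak_norm (q i) (x i).
have [N XN] := choice (fun i => (XL i).2 m (x i)).
(* One index set large enough for the factorizations of all coordinates. *)
pose I := 'I_(\max_i N i).
have NI i : (N i <= #|I|)%N by rewrite card_ord leq_bigmax.
pose T i := sval (cid (XN i I (NI i))).
have /choice[z Tz] i := svalP (cid (XN i I (NI i))).
(* [D] bounds the composed forms on the unit cube, since [T i] has norm at most [L i * w i]
   there. *)
pose D := C * \prod_i (L i * w i).
have Tlin i := let: And4 Tl _ _ _ := Tz i in Tl.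
have sum_re d : rnorm (d : (scalar_field R k)^o) <= 1 ->
    \sum_j `|scalar_re (d * A (fun i => x i j))| <= c * D.
  move=> d1; have Blin := real_multilinear_comp d Alin Tlin.
  have zx j : (fun i => x i j) = (fun i => T i (z i j)).
    apply: functional_extensionality_dep => i; have [_ Tzx _ _] := Tz i.
    by rewrite [RHS]Tzx.
  under eq_bigr do rewrite zx.
  apply: (multilinear_grothendieck Blin _ (u := fun j i => z i j)) => [v v1|i l].
    apply: le_trans (rabs_re _) _; rewrite rabsM.
    apply: le_trans (_ : rnorm (A (fun i => T i (v i)) : (scalar_field R k)^o) <= _).
      by rewrite ler_piMl ?rnorm_ge0.
    apply: le_trans (A_le _) _; rewrite ler_wpM2l // ler_prod // => i _.
    by rewrite rnorm_ge0; have [_ _ Tle _] := Tz i; exact: Tle.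
  by rewrite expr1n; have [_ _ _] := Tz i; apply.
have -> : 2 * c * C * (\prod_i L i) * (\prod_i weak_norm (q i) (x i)) = c * D + c * D.
  by rewrite /D big_split /=; ring.
rewrite invr1 powRr1; last by apply: sumr_ge0 => j _; exact: powR_ge0.
apply: le_trans (_ : \sum_(j < m) (`|scalar_re (1 * A (fun i => x i j))|
    + `|scalar_re (scalar_i k * A (fun i => x i j))|) <= _).
  apply: ler_sum => j _; rewrite powRr1 ?rnorm_ge0 // scalar_rei normrN mul1r.
  exact: rabs_le.
rewrite big_split lerD ?sum_re ?rabs_i //.
by rewrite -(scalar_of_real1 R k) rabsK normr1.
Qed.

Theorem corollary2 (R : realType) (k : scalar_kind) (n s : nat)
    (X : 'I_n -> completeNormedModType (scalar_field R k))
    (hn : (2 <= n)%N) (hs : (1 <= s <= n)%N)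
    (hX : forall i : 'I_n, (i < s)%N -> infinite_dim_Linfty_space (X i)) :
  @continuous_multilinear R k n X =
  @absolutely_summing R k n X 1 (fun i : 'I_n => if (i < s)%N then 2 else 1).
Proof.
case: n X hn hs hX => [//|[//|n]] X _ _ hX.
apply/seteqP; split=> [A A_cm|A [] //].
apply: factorization_summing A_cm => i; first by case: ifP.
case: ifPn => [/hX|_]; [exact: linfty_factorization2|exact: linfty_factorization1].
Qed.
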